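(* Consider a finite POMDP with geometrically distributed horizon as in the context. Define the belief-state cost function $$G(\pi_k,u_k)\triangleq(1-\gamma)\beta\tilde G_1(\pi_k)+\gamma\beta\tilde G_2(\pi_k,u_k)+\gamma\lambda\tilde G_3(\pi_k,u_k)+E_{X_k}\big[(1-\gamma)c_T(X_k)+\gamma c(X_k,U_k)\,\big|\,\pi_k,U_k=u_k\big],$$ where the last expectation equals $\sum_{x\in\mathcal X}\pi_k(x)[(1-\gamma)c_T(x)+\gamma c(x,u_k)]$. Then the entropy-regularized problem $$\inf_{\mu\in\mathcal P}\; E_T\big[J_\mu^T+\beta H_\mu(X^T\mid Y^T,U^{T-1})+\lambda H_\mu(Y^T,U^{T-1})\big]$$ (subject to the POMDP dynamics of the context) with $\beta,\lambda\ge0$ is equivalent (up to $\lambda H(Y_0)$) to $$\inf_{\bar\mu}\;E_{\bar\mu}\Big[\sum_{k=0}^\infty\gamma^kG(\pi_k,U_k)\,\Big|\,\pi_0\Big]$$ subject to $\pi_{k+1}=\Pi(\pi_k,U_k,Y_{k+1})$, $Y_{k+1}\mid \pi_k,U_k\sim p(y_{k+1}\mid\pi_k,u_k)$, and $U_k=\bar\mu(\pi_k)\in\mathcal U$, where the optimization is over deterministic, stationary policies $\bar\mu:\Delta\to\mathcal U$ that are functions of the belief state $\pi_k$, and $\gamma$ is the parameter of the geometric distribution of $T$.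
   Context: All logarithms are base 2, with $0\log 0=0$ and terms of probability zero contributing $0$; empty sums are $0$ and empty products are $1$. Superscripts denote trajectories: $X^T=(X_0,\dots,X_T)$, $x^T=(x_0,\dots,x_T)$, and similarly for $Y^T$, $U^{T-1}$; $U^{-1}$ is empty. POMDP: finite sets $\mathcal X=\{1,\dots,N_x\}$ (states), $\mathcal U=\{1,\dots,N_u\}$ (controls), $\mathcal Y=\{1,\dots,N_y\}$ (observations); $\Delta=\{\pi\in[0,1]^{N_x}:\sum_{x\in\mathcal X}\pi(x)=1\}$; initial pmf $\rho\in\Delta$ of $X_0$; transition kernel $A^{x,\bar x}(u)=p(X_{k+1}=x\mid X_k=\bar x,U_k=u)$; observation kernel $B^{x,y}(u)=p(Y_k=y\mid X_k=x,U_{k-1}=u)$ for $k>0$ and $B^{x_0,y_0}=p(Y_0=y_0\mid X_0=x_0)$. A policy is $\mu=\{\mu_k^{i_k}:k\ge0\}$, where for each realization $i_k=(y^k,u^{k-1})$ of the information state $I_k=(Y^k,U^{k-1})$, $\mu_k^{i_k}(u_k)=p(U_k=u_k\mid Y^k=y^k,U^{k-1}=u^{k-1})$ is a pmf on $\mathcal U$; $\mathcal P$ is the set of all policies (stochastic or deterministic). Under $\mu$, $$p_\mu(x^T,y^T,u^{T-1})=\rho(x_0)B^{x_0,y_0}\prod_{k=0}^{T-1}A^{x_{k+1},x_k}(u_k)\,\mu_k^{i_k}(u_k)\,B^{x_{k+1},y_{k+1}}(u_k),$$ and $E_\mu$ is the corresponding expectation. Costs and entropies for a horizon $T\ge 0$: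 $J_\mu^T=E_\mu[c_T(X_T)+\sum_{k=0}^{T-1}c(X_k,U_k)]$ with arbitrary $c:\mathcal X\times\mathcal U\to\mathbb R$, $c_T:\mathcal X\to\mathbb R$; smoother entropy $H_\mu(X^T\mid Y^T,U^{T-1})=-E_\mu[\log p_\mu(X^T\mid Y^T,U^{T-1})]$; input-output entropy $H_\mu(Y^T,U^{T-1})=-E_\mu[\log p_\mu(Y^T,U^{T-1})]$. $H(Y_0)$ is the entropy of $Y_0$, which does not depend on $\mu$. The horizon $T$ is a random variable with geometric distribution, $P(T=t)=\gamma^t(1-\gamma)$ for $t\ge0$, with parameter $0<\gamma<1$, and $E_T$ denotes expectation over $T$. Belief state: $\pi_k\in\Delta$ with $\pi_k(x)=p(X_k=x\mid y^k,u^{k-1})$, where $\pi_0(x)=B^{x,y_0}\rho(x)/\sum_{\bar x\in\mathcal X}B^{\bar x,y_0}\rho(\bar x)$ and $\pi_{k+1}=\Pi(\pi_k,u_k,y_{k+1})$ is the Bayesian filter $$\Pi(\pi,u,y)(x)=\frac{B^{x,y}(u)\sum_{\bar x\in\mathcal X}A^{x,\bar x}(u)\pi(\bar x)}{\sum_{\underline x\in\mathcal X}\sum_{\bar x\in\mathcal X}B^{\underline x,y}(u)A^{\underline x,\bar x}(u)\pi(\bar x)},$$ and $p(y\mid\pi,u)=\sum_{x,\bar x\in\mathcal X}B^{x,y}(u)A^{x,\bar x}(u)\pi(\bar x)$. Belief functions: $\tilde G_1(\pi)=-\sum_{x\in\mathcal X}\pi(x)\log\pi(x)$; $$\tilde G_2(\pi,u)=\sum_{x,\bar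 x\in\mathcal X}A^{x,\bar x}(u)\pi(\bar x)\log\sum_{\underline x\in\mathcal X}\frac{A^{x,\underline x}(u)\pi(\underline x)}{A^{x,\bar x}(u)\pi(\bar x)};$$ $\tilde G_3(\pi,u)=-\sum_{y\in\mathcal Y}p(y\mid\pi,u)\log p(y\mid\pi,u)$. *)

(* Defs.v *)
From HB Require Import structures.
From mathcomp Require Import all_boot all_order all_algebra.
From mathcomp Require Import all_classical all_reals all_analysis.
From mathcomp Require Import measurable_realfun.
Import numFieldNormedType.Exports.

Set Implicit Arguments.
Unset Strict Implicit.
Unset Printing Implicit Defensive.

Import Order.TTheory GRing.Theory Num.Theory.
Local Open Scope classical_set_scope.
Local Open Scope ring_scope.

(** * Probability mass functions on finite sets *)

Definition is_pmf (R : realType) (T : finType) (f : T -> R) : Prop :=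
  (forall t, 0 <= f t) /\ \sum_t f t = 1.

Record dist (R : realType) (T : finType) := Dist {
  dist_fun :> T -> R ;
  distP : is_pmf dist_fun }.

(** [dist_or f p] is [f] if [f] is a pmf, and [p] otherwise.  It makes Bayes'
    rule total: [p] is only used when conditioning on a null event. *)
Definition dist_or (R : realType) (T : finType) (f : T -> R) (p : dist R T) :
    dist R T :=
  if pselect (is_pmf f) is left h then Dist h else p.

Lemma dist_ge0 (R : realType) (T : finType) (p : dist R T) t : 0 <= p t.
Proof. exact: (distP p).1. Qed.

Lemma dist_sum1 (R : realType) (T : finType) (p : dist R T) : \sum_t p t = 1.
Proof. exact: (distP p).2. Qed.

Lemma dist_inhabited (R : realType) (T : finType) (p : dist R T) :
  exists t : T, True.
Proof.
apply: contrapT => h; have := dist_sum1 p; rewrite big1 => [|t _].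
  by move=> /esym/eqP; rewrite oner_eq0.
by case: h; exists t.
Qed.

Lemma dirac_pmf (R : realType) (T : finType) (a : T) :
  is_pmf (fun t => (t == a)%:R : R).
Proof.
split=> [t|]; first exact: ler0n.
by rewrite (bigD1 a) //= eqxx big1 ?addr0 // => t /negbTE ->.
Qed.

Definition dirac_dist (R : realType) (T : finType) (a : T) : dist R T :=
  Dist (dirac_pmf R a).

(** Base-2 logarithm; [ln 0 = 0], so [0 * log2 0 = 0]. *)
Definition log2 (R : realType) (r : R) : R := ln r / ln 2.

Definition entropy (R : realType) (T : finType) (f : T -> R) : R :=
  - \sum_t f t * log2 (f t).

(** * Finite POMDPs *)

(** [trans M u xbar x] is A^{x,xbar}(u), [obs0 M x y] is B^{x,y} and
    [obs M u x y] is B^{x,y}(u). *)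
Record pomdp (R : realType) (X U Y : finType) := POMDP {
  init : dist R X ;
  trans : U -> X -> dist R X ;
  obs0 : X -> dist R Y ;
  obs : U -> X -> dist R Y }.

(** [mu ys us] is the pmf of U_k given the information state
    (Y^k, U^{k-1}) = (ys, us), where size ys = k+1 and size us = k; the values
    at other pairs of sequences play no role. *)
Definition policy (R : realType) (U Y : finType) := seq Y -> seq U -> dist R U.

Section finite_horizon.
Context {R : realType} {X U Y : finType}.
Variables (M : pomdp R X U Y) (c : X -> U -> R) (cT : X -> R).
Variables (mu : policy R U Y) (T : nat).

(** x^T and y^T are (T+1)-tuples and u^{T-1} is a T-tuple.  For k < T,
    [widen_ord (leqnSn T) k] and [lift ord0 k] are the indices k and k+1. *)
Definition traj_pmf (x : T.+1.-tuple X) (y : T.+1.-tuple Y) (u : T.-tuple U) : R :=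
  init M (tnth x ord0) * obs0 M (tnth x ord0) (tnth y ord0) *
  \prod_(k < T)
    (trans M (tnth u k) (tnth x (widen_ord (leqnSn T) k)) (tnth x (lift ord0 k))
     * mu (take k.+1 y) (take k u) (tnth u k)
     * obs M (tnth u k) (tnth x (lift ord0 k)) (tnth y (lift ord0 k))).

Definition traj_expectation
    (f : T.+1.-tuple X -> T.+1.-tuple Y -> T.-tuple U -> R) : R :=
  \sum_x \sum_y \sum_u traj_pmf x y u * f x y u.

Definition io_pmf (y : T.+1.-tuple Y) (u : T.-tuple U) : R :=
  \sum_x traj_pmf x y u.

Definition smoother_pmf (x : T.+1.-tuple X) (y : T.+1.-tuple Y)
    (u : T.-tuple U) : R :=
  traj_pmf x y u / io_pmf y u.

Definition total_cost : R :=
  traj_expectation (fun x y u => cT (tnth x ord_max) +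
    \sum_(k < T) c (tnth x (widen_ord (leqnSn T) k)) (tnth u k)).

Definition smoother_entropy : R :=
  - traj_expectation (fun x y u => log2 (smoother_pmf x y u)).

Definition io_entropy : R :=
  - traj_expectation (fun x y u => log2 (io_pmf y u)).

End finite_horizon.

Definition obs0_pmf (R : realType) (X U Y : finType) (M : pomdp R X U Y)
    (y : Y) : R :=
  \sum_x obs0 M x y * init M x.

(** * Belief states and the Bayesian filter *)

Section belief.
Context {R : realType} {X U Y : finType}.
Variable M : pomdp R X U Y.

Definition init_belief (y : Y) : dist R X :=
  dist_or (fun x => obs0 M x y * init M x / \sum_xbar obs0 M xbar y * init M xbar)
    (init M).

Definition bayes (pi : dist R X) (u : U) (y : Y) : dist R X :=
  dist_or (fun x =>
      obs M u x y * (\sum_xbar trans M u xbar x * pi xbar) /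
      \sum_xund \sum_xbar obs M u xund y * trans M u xbar xund * pi xbar)
    pi.

Lemma next_obs_pmf (pi : dist R X) (u : U) :
  is_pmf (fun y => \sum_x \sum_xbar obs M u x y * trans M u xbar x * pi xbar).
Proof.
split=> [y|].
  by apply: sumr_ge0 => x _; apply: sumr_ge0 => z _; rewrite !mulr_ge0 ?dist_ge0.
rewrite exchange_big /=.
under eq_bigr => x _.
  rewrite exchange_big /=.
  under eq_bigr => z _.
    under eq_bigr => y _ do rewrite -mulrA.
    by rewrite -mulr_suml dist_sum1 mul1r; over.
  over.
rewrite exchange_big /= -[RHS](dist_sum1 pi); apply: eq_bigr => z _.
by rewrite -mulr_suml dist_sum1 mul1r.
Qed.

(** [next_obs pi u y] is p(y | pi, u). *)
Definition next_obs (pi : dist R X) (u : U) : dist R Y := Dist (next_obs_pmf pi u).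

(** The belief pi_k reached at the information state (y^k, u^{k-1}). *)
Definition filter_belief (ys : seq Y) (us : seq U) : dist R X :=
  if ys is y0 :: ys' then
    foldl (fun pi uy => bayes pi uy.1 uy.2) (init_belief y0) (zip us ys')
  else init M.

(** The policy of the POMDP that plays U_k = mubar(pi_k). *)
Definition belief_policy (mubar : dist R X -> U) : policy R U Y :=
  fun ys us => dirac_dist R (mubar (filter_belief ys us)).

End belief.

(** * The belief-state cost *)

Section belief_cost.
Context {R : realType} {X U Y : finType}.
Variables (M : pomdp R X U Y) (c : X -> U -> R) (cT : X -> R).
Variables (beta lambda gamma : R).

Definition G1 (pi : dist R X) : R := entropy pi.

Definition G2 (pi : dist R X) (u : U) : R :=
  \sum_x \sum_xbar trans M u xbar x * pi xbar *
    log2 (\sum_xund (trans M u xund x * pi xund) / (trans M u xbar x * pi xbar)).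

Definition G3 (pi : dist R X) (u : U) : R := entropy (next_obs M pi u).

Definition belief_cost (pi : dist R X) (u : U) : R :=
  (1 - gamma) * beta * G1 pi + gamma * beta * G2 pi u + gamma * lambda * G3 pi u
  + \sum_x pi x * ((1 - gamma) * cT x + gamma * c x u).

End belief_cost.

(** * Random sequences on a finite alphabet with prescribed conditional pmfs

    [q s] is the conditional pmf of the next letter given that the past is [s].
    A realization is built on [0, 1[ with the uniform probability: the letter is
    read off a partition of [0, 1[ into intervals of lengths [q [::] y], and the
    relative position in the selected interval drives the rest. *)

Section random_sequence.
Context {R : realType} {Y : finType}.
Variable y0 : Y.
Implicit Types (p : dist R Y) (q : seq Y -> dist R Y) (w : R).

Definition part_sum p (n : nat) : R := \sum_(0 <= i < n) p (nth y0 (enum Y) i).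

Definition cell_lo p (y : Y) : R := part_sum p (index y (enum Y)).

Definition in_cell p w (y : Y) : bool := cell_lo p y <= w < cell_lo p y + p y.

Definition letter p w : Y := odflt y0 [pick y | in_cell p w y].

Fixpoint coord (n : nat) q w : Y :=
  let y := letter (q [::]) w in
  if n is n'.+1 then
    coord n' (fun s => q (y :: s)) ((w - cell_lo (q [::]) y) / q [::] y)
  else y.

Lemma part_sumS p n : part_sum p n.+1 = part_sum p n + p (nth y0 (enum Y) n).
Proof. by rewrite /part_sum big_nat_recr. Qed.

Lemma part_sum_mono p : {homo part_sum p : m n / (m <= n)%N >-> m <= n}.
Proof.
apply: homo_leq => // [x y z|n]; first exact: le_trans.
by rewrite part_sumS lerDl dist_ge0.
Qed.

Lemma part_sum_card p : part_sum p #|Y| = 1.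
Proof.
rewrite -(dist_sum1 p) /part_sum cardE -(big_nth y0 xpredT) big_enum.
by apply: eq_bigl.
Qed.

Lemma cell_hi p y : cell_lo p y + p y = part_sum p (index y (enum Y)).+1.
Proof. by rewrite part_sumS nth_index // mem_enum. Qed.

Lemma cell_lo_ge0 p y : 0 <= cell_lo p y.
Proof. by rewrite -[0](_ : part_sum p 0 = 0) ?part_sum_mono // /part_sum big_geq. Qed.

Lemma cell_hi_le1 p y : cell_lo p y + p y <= 1.
Proof.
by rewrite cell_hi -(part_sum_card p) part_sum_mono // cardE index_mem mem_enum.
Qed.

Lemma in_cell_inj p w y z : in_cell p w y -> in_cell p w z -> y = z.
Proof.
rewrite /in_cell !cell_hi => /andP[y1 y2] /andP[z1 z2].
have memY x : x \in enum Y by rewrite mem_enum.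
suff : index y (enum Y) = index z (enum Y).
  by move/(congr1 (nth y0 (enum Y))); rewrite !nth_index.
apply/eqP; rewrite eqn_leq.
apply/andP; split; rewrite leqNgt; apply/negP => /(part_sum_mono p) h.
  by have := le_lt_trans y1 z2; rewrite ltNge h.
by have := le_lt_trans z1 y2; rewrite ltNge h.
Qed.

Lemma in_cell_ex p w : 0 <= w < 1 -> exists y, in_cell p w y.
Proof.
move=> /andP[w0 w1].
have ex : exists n, w < part_sum p n by exists #|Y|; rewrite part_sum_card.
case: (ex_minnP ex) => -[|n]; first by rewrite /part_sum big_geq // ltNge w0.
move=> wn nmin; have nY : (n < size (enum Y))%N.
  by rewrite -cardE; apply: nmin; rewrite part_sum_card.
exists (nth y0 (enum Y) n); rewrite /in_cell cell_hi /cell_lo.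
rewrite index_uniq ?enum_uniq // wn andbT leNgt; apply/negP => /nmin.
by rewrite ltnn.
Qed.

Lemma letterP p w y : 0 <= w < 1 -> (letter p w == y) = in_cell p w y.
Proof.
move=> w01; rewrite /letter; case: pickP => [z hz|h] /=.
  by apply/eqP/idP => [<- //|/(in_cell_inj hz)].
by have [z] := in_cell_ex p w01; rewrite h.
Qed.

Lemma measurable_in_cell p y : measurable [set w | in_cell p w y].
Proof.
rewrite (_ : [set _ | _] = `[cell_lo p y, cell_lo p y + p y[%classic);
  first exact: measurable_itv.
by apply/seteqP; split=> w /=; rewrite in_itv.
Qed.

Lemma measurable_letter p y : measurable [set w | letter p w = y].
Proof.
have [->|yy0] := eqVneq y y0.
  rewrite (_ : [set _ | _] =
     ~` \bigcup_(z in [set z | z != y0]) [set w | in_cell p w z]).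
    apply: measurableC; apply: fin_bigcup_measurable; first exact: finite_finset.
    by move=> z _; exact: measurable_in_cell.
  apply/seteqP; split=> w /=.
    rewrite /letter; case: pickP => [z hz /= zy0|h _] [t /= ty0 ht].
      by move/negP: ty0; apply; rewrite (in_cell_inj ht hz) zy0.
    by rewrite h in ht.
  move=> h; rewrite /letter; case: pickP => [z hz /=|//].
  apply/eqP; apply: contra_notT h => zy0.
  by exists z.
rewrite (_ : [set _ | _] = [set w | in_cell p w y]);
  first exact: measurable_in_cell.
apply/seteqP; split=> w /=; rewrite /letter; case: pickP => [z hz|h] /=.
- by move=> <-.
- by move=> /esym /eqP; rewrite (negbTE yy0).
- exact: in_cell_inj.
- by rewrite h.
Qed.

Lemma measurable_coord n q y : measurable [set w | coord n q w = y].
Proof.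
elim: n q => [|n IHn] q /=; first exact: measurable_letter.
rewrite (_ : [set _ | _] = \bigcup_(z in [set: Y])
  ([set w | letter (q [::]) w = z] `&` (fun w : R =>
    (w - cell_lo (q [::]) z) / q [::] z) @^-1`
    [set w | coord n (fun s => q (z :: s)) w = y])).
  apply: fin_bigcup_measurable => [|z _]; first exact: finite_finset.
  apply: measurableI;
    first exact: measurable_letter.
  rewrite -[X in measurable X]setTI.
  apply: (_ : measurable_fun setT _) => //.
  by apply: measurable_funM => //; apply: measurable_funB.
apply/seteqP; split=> w /=; first by exists (letter (q [::]) w).
by move=> [z _ [<-]].
Qed.

Fixpoint cyl_lo q (s : seq Y) : R :=
  if s is y :: s' then
    cell_lo (q [::]) y + q [::] y * cyl_lo (fun t => q (y :: t)) s'
  else 0.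

Fixpoint cyl_len q (s : seq Y) : R :=
  if s is y :: s' then q [::] y * cyl_len (fun t => q (y :: t)) s' else 1.

Lemma cyl_len_ge0 q s : 0 <= cyl_len q s.
Proof. by elim: s q => [|y s IHs] q //=; rewrite mulr_ge0 ?dist_ge0. Qed.

Lemma cyl_lo_ge0 q s : 0 <= cyl_lo q s.
Proof.
by elim: s q => [|y s IHs] q //=; rewrite addr_ge0 ?cell_lo_ge0 // mulr_ge0 ?dist_ge0.
Qed.

Lemma cyl_hi_le1 q s : cyl_lo q s + cyl_len q s <= 1.
Proof.
elim: s q => [|y s IHs] q /=; first by rewrite add0r.
rewrite -addrA -mulrDr; apply: le_trans (cell_hi_le1 (q [::]) y).
by rewrite lerD2l ler_piMr ?dist_ge0.
Qed.

Lemma cyl_lenE n q (s : n.-tuple Y) :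
  cyl_len q s = \prod_(i < n) q (take i s) (tnth s i).
Proof.
elim: n q s => [|n IHn] q s; first by rewrite big_ord0 tuple0.
case/tupleP: s => y s /=; rewrite big_ord_recl /= tnth0; congr (_ * _).
by rewrite IHn; apply: eq_bigr => i _; rewrite tnthS.
Qed.

Lemma coord_cyl n q (s : n.-tuple Y) w : 0 <= w < 1 ->
  (forall i : 'I_n, coord i q w = tnth s i) <->
  cyl_lo q s <= w < cyl_lo q s + cyl_len q s.
Proof.
elim: n q s w => [|n IHn] q s w w01.
  by rewrite (tuple0 s) /= add0r w01; split=> // _ [].
case/tupleP: s => y s /=.
set p := q [::]; set w' := (w - cell_lo p y) / p y.
have pge0 := dist_ge0 p y.
have -> : (forall i : 'I_n.+1, coord i q w = tnth [tuple of y :: s] i) <->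
   (letter p w = y /\
    forall i : 'I_n, coord i (fun t => q (y :: t)) w' = tnth s i).
  split=> [h|[h0 h] i].
    have h0 : letter p w = y by have := h ord0; rewrite tnth0 /=.
    split=> // i; have := h (lift ord0 i); rewrite tnthS /=.
    by rewrite -/p h0.
  case: (unliftP ord0 i) => [j ->|->]; last by rewrite tnth0.
  by rewrite tnthS /= -/p h0 h.
have [py0|pyN0] := eqVneq (p y) 0.
  split=> [[/eqP]|].
    rewrite letterP // /in_cell py0 addr0 => /andP[h1 h2].
    by have := le_lt_trans h1 h2; rewrite ltxx.
  rewrite py0 !mul0r !addr0 => /andP[h1 h2].
  by have := le_lt_trans h1 h2; rewrite ltxx.
have py_gt0 : 0 < p y by rewrite lt_neqAle eq_sym pyN0.
have cellE : in_cell p w y = (0 <= w' < 1).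
  by rewrite /in_cell /w' ler_pdivlMr // mul0r ltr_pdivrMr // mul1r ltrBlDl subr_ge0.
have wE : w = cell_lo p y + p y * w' by rewrite /w' mulrCA divff // mulr1 addrCA subrr addr0.
have cylE : (cell_lo p y + p y * cyl_lo (fun t => q (y :: t)) s <= w <
     cell_lo p y + p y * cyl_lo (fun t => q (y :: t)) s +
     p y * cyl_len (fun t => q (y :: t)) s) =
   (cyl_lo (fun t => q (y :: t)) s <= w' <
    cyl_lo (fun t => q (y :: t)) s + cyl_len (fun t => q (y :: t)) s).
  by rewrite [in LHS]wE -addrA lerD2l ltrD2l -mulrDr ler_pM2l // ltr_pM2l.
rewrite cylE; split=> [[/eqP]|].
  by rewrite letterP // cellE => w'01 /(IHn _ _ _ w'01).
move=> h; have w'01 : 0 <= w' < 1.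
  case/andP: h => h1 h2; rewrite (le_trans (cyl_lo_ge0 _ _) h1) /=.
  exact: lt_le_trans h2 (cyl_hi_le1 _ _).
by split; [apply/eqP; rewrite letterP // cellE | apply/IHn].
Qed.

Lemma measurable_cyl n q (s : n.-tuple Y) :
  measurable [set w | forall i : 'I_n, coord i q w = tnth s i].
Proof.
rewrite (_ : [set _ | _] =
    \bigcap_(i in [set: 'I_n]) [set w | coord i q w = tnth s i]).
  apply: fin_bigcap_measurable => [|i _]; first exact: finite_finset.
  exact: measurable_coord.
by apply/seteqP; split=> w /= h i => [_|]; exact: h.
Qed.

Let U01 := uniform_prob (@ltr01 R).

Lemma uniform_itv a b : 0 <= a -> a <= b -> b <= 1 ->
  U01 `[a, b[%classic = (b - a)%:E.
Proof.
move=> a0 ab b1; rewrite /U01 /uniform_prob.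
rewrite (eq_integral (cst 1%E)) => [|x]; last first.
  rewrite inE /= in_itv /= => /andP[ax xb]; rewrite /uniform_pdf.
  by rewrite (le_trans a0 ax) (le_trans (ltW xb) b1) subr0 invr1.
rewrite integral_cst; last exact: measurable_itv.
rewrite mul1e [LHS](lebesgue_measure_itv `[a, b[) /= lte_fin EFinB.
by case: ltP => // ba; rewrite (le_anti (introT andP (conj ab ba))) subee.
Qed.

Lemma uniform_cyl n q (s : n.-tuple Y) :
  U01 [set w | forall i : 'I_n, coord i q w = tnth s i] =
  (\prod_(i < n) q (take i s) (tnth s i))%:E.
Proof.
set C := [set _ | _].
have mC : measurable C by exact: measurable_cyl.
have mI : measurable (`[0, 1[%classic : set R) by exact: measurable_itv.
have PI : U01 `[0, 1[%classic = 1%E by rewrite uniform_itv ?ler01 // subr0.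
have PIC : U01 (~` `[0, 1[%classic) = 0%E.
  by rewrite [LHS](probability_setC U01 mI) [X in (1 - X)%E]PI subee.
have -> : U01 C = U01 (C `&` `[0, 1[%classic).
  rewrite [LHS](measureDI U01 mC mI) [X in (X + _)%E](_ : _ = 0%E) ?add0e //.
  apply: (subset_measure0 (mu := U01) _ _ _ PIC); first exact: measurableD.
    exact: measurableC.
  by move=> w [].
have -> : C `&` `[0, 1[%classic =
    `[cyl_lo q s, cyl_lo q s + cyl_len q s[%classic.
  apply/seteqP; split=> w /=; rewrite !in_itv /=.
    by move=> [h w01]; apply/(coord_cyl q s w01).
  move=> h; have w01 : 0 <= w < 1.
    case/andP: h => h1 h2; rewrite (le_trans (cyl_lo_ge0 _ _) h1) /=.
    exact: lt_le_trans h2 (cyl_hi_le1 _ _).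
  by split=> //; apply/coord_cyl.
rewrite uniform_itv ?cyl_lo_ge0 ?lerDl ?cyl_len_ge0 ?cyl_hi_le1 //.
by rewrite addrC addKr cyl_lenE.
Qed.

End random_sequence.

(** * The infinite-horizon belief-state problem *)

(** The space of the sequences (Y_1, Y_2, ...) of observations, [w k] being
    Y_{k+1}, with the sigma-algebra generated by the cylinders.  The POMDP is a
    parameter only because measurable types are pointed. *)
Definition obs_path (R : realType) (X U Y : finType) (M : pomdp R X U Y) : Type :=
  nat -> Y.

Section obs_path.
Context {R : realType} {X U Y : finType}.
Variable M : pomdp R X U Y.

Lemma obs_inhabited : exists y : Y, True.
Proof. by have [x _] := dist_inhabited (init M); exact: dist_inhabited (obs0 M x). Qed.

Definition some_obs : Y := sval (cid obs_inhabited).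

HB.instance Definition _ := Choice.on (obs_path M).
HB.instance Definition _ := isPointed.Build (obs_path M) (fun=> some_obs).

Definition cylinder n (s : n.-tuple Y) : set (obs_path M) :=
  [set w | forall i : 'I_n, w i = tnth s i].

Definition cylinders : set (set (obs_path M)) :=
  [set C | exists n (s : n.-tuple Y), C = cylinder s].

Definition obs_space : measurableType cylinders.-sigma :=
  g_sigma_algebraType cylinders.

Variables (mubar : dist R X -> U) (pi0 : dist R X).

Definition belief_after (s : seq Y) : dist R X :=
  foldl (fun pi y => bayes M pi (mubar pi) y) pi0 s.

Fixpoint belief_process (k : nat) (w : nat -> Y) : dist R X :=
  if k is k'.+1 then
    let pi := belief_process k' w in bayes M pi (mubar pi) (w k')
  else pi0.

Lemma belief_processE k w : belief_process k w = belief_after (mkseq w k).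
Proof.
elim: k => //= k IHk.
by rewrite /belief_after mkseqS foldl_rcons -/(belief_after _) -IHk.
Qed.

Lemma obs_law_ex : exists P : probability obs_space R,
  forall n (s : n.-tuple Y), P (cylinder s) =
  (\prod_(k < n) next_obs M (belief_after (take k s))
                    (mubar (belief_after (take k s))) (tnth s k))%:E.
Proof.
pose q s := next_obs M (belief_after s) (mubar (belief_after s)).
pose Z (w : measurableTypeR R) : obs_space := fun n => coord some_obs n q w.
have mZ : measurable_fun [set: measurableTypeR R] Z.
  apply: (@measurability _ _ (measurableTypeR R) obs_space _ _ cylinders) => //.
  by move=> _ [_ [n [s ->]] <-]; rewrite setTI; exact: measurable_cyl.
pose Zm : {mfun (measurableTypeR R) >-> obs_space} := mfun_Sub (mem_set mZ).
exists (distribution (uniform_prob (@ltr01 R)) Zm) => n s.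
exact: (uniform_cyl some_obs q s).
Qed.

(** The law of (Y_1, Y_2, ...) when Y_{k+1} | pi_k, U_k ~ p(. | pi_k, U_k) and
    U_k = mubar(pi_k), from the initial belief [pi0]; it is characterized by
    [obs_lawP], as the cylinders and the empty set generate the sigma-algebra
    and are stable under intersection. *)
Definition obs_law : probability obs_space R := sval (cid obs_law_ex).

Lemma obs_lawP n (s : n.-tuple Y) : obs_law (cylinder s) =
  (\prod_(k < n) next_obs M (belief_after (take k s))
                    (mubar (belief_after (take k s))) (tnth s k))%:E.
Proof. exact: (svalP (cid obs_law_ex)). Qed.

End obs_path.

Section problems.
Context {R : realType} {X U Y : finType}.
Variables (M : pomdp R X U Y) (c : X -> U -> R) (cT : X -> R).
Variables (beta lambda gamma : R).

(** E_{mubar}[\sum_k gamma^k G(pi_k, U_k) | pi_0 = pi0] *)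
Definition belief_value (mubar : dist R X -> U) (pi0 : dist R X) : \bar R :=
  'E_(obs_law M mubar pi0)[fun w => limn (fun n => \sum_(0 <= k < n)
     let pi := belief_process M mubar pi0 k w in
     gamma ^+ k * belief_cost M c cT beta lambda gamma pi (mubar pi))].

Definition regularized_cost (mu : policy R U Y) (t : nat) : R :=
  total_cost M c cT mu t + beta * smoother_entropy M mu t
  + lambda * io_entropy M mu t.

End problems.

(* Main.v *)
(** Write I_k = (Y^k, U^{k-1}).  The chain rule for (X_k, X_{k+1}, Y_{k+1}) given
    I_k and U_k shows that going from T to T+1 adds to the regularized cost the
    expectation of a function of pi_T and U_T, plus lambda times the entropy of
    the randomization of U_T, while the terminal term moves from pi_T to pi_{T+1}.
    Averaging over the geometric T turns this into a discounted cost with stage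
    cost G(pi_k, U_k) + gamma lambda H(mu_k).  The last term is nonnegative and
    vanishes for deterministic policies, so what remains is a discounted Markov
    decision process on the beliefs with bounded cost and finitely many actions.
    Its Bellman equation has a bounded solution V, which is below the value of
    every history-dependent randomized policy and is the value of the stationary
    deterministic policy that is greedy for V. *)

Require Import Defs.
From HB Require Import structures.
From mathcomp Require Import all_boot all_order all_algebra.
From mathcomp Require Import all_classical all_reals all_analysis.
From mathcomp Require Import measurable_realfun ring lra.
Import numFieldNormedType.Exports.

Set Implicit Arguments.
Unset Strict Implicit.
Unset Printing Implicit Defensive.

Import Order.TTheory GRing.Theory Num.Theory.
Local Open Scope classical_set_scope.
Local Open Scope ring_scope.

(** * Base-2 logarithms and the function x log x *)

Section xlog.
Context {R : realType}.
Implicit Types a b x : R.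

Definition xlog x : R := x * log2 x.

Lemma ln2_gt0 : 0 < ln 2 :> R.
Proof. by rewrite ln_gt0 // ltr1n. Qed.

Lemma log2M a b : 0 < a -> 0 < b -> log2 (a * b) = log2 a + log2 b.
Proof. by move=> a0 b0; rewrite /log2 lnM ?posrE // mulrDl. Qed.

Lemma log2_div a b : 0 < a -> 0 < b -> log2 (a / b) = log2 a - log2 b.
Proof. by move=> a0 b0; rewrite /log2 ln_div ?posrE // mulrBl. Qed.

Lemma xlog0 : xlog 0 = 0.
Proof. by rewrite /xlog mul0r. Qed.

(** A null factor makes both sides vanish; otherwise this is additivity of the logarithm. The
    one-step entropy chain rules come from this product rule. *)
Lemma xlogM a b : 0 <= a -> 0 <= b -> xlog (a * b) = b * xlog a + a * xlog b.
Proof.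
rewrite 2!le_eqVlt => /predU1P[<-|a0]; first by rewrite !(mul0r, xlog0, mulr0, addr0).
move=> /predU1P[<-|b0]; first by rewrite !(mul0r, xlog0, mulr0, addr0).
by rewrite /xlog log2M //; ring.
Qed.

(** The bound [a <= b] makes [b] positive unless [a] is zero, so ratios of probabilities need no
    separate treatment of null events. *)
Lemma mul_log2_div a b : 0 <= a -> a <= b -> a * log2 (a / b) = xlog a - a * log2 b.
Proof.
rewrite le_eqVlt => /predU1P[<- _|a0 ab]; first by rewrite !mul0r xlog0 subr0.
by rewrite /xlog log2_div // ?mulrBr // (lt_le_trans a0).
Qed.

Lemma mul_log2_div_inv a b : 0 <= a -> a <= b -> a * log2 (b / a) = a * log2 b - xlog a.
Proof.
rewrite le_eqVlt => /predU1P[<- _|a0 ab]; first by rewrite !mul0r xlog0 subr0.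
by rewrite /xlog log2_div // ?mulrBr // (lt_le_trans a0).
Qed.

Lemma mul_log2_div_ge0 a b : 0 <= a -> a <= b -> 0 <= a * log2 (b / a).
Proof.
rewrite le_eqVlt => /predU1P[<- _|a0 ab]; first by rewrite mul0r.
rewrite mulr_ge0 ?(ltW a0) // /log2 divr_ge0 ?(ltW ln2_gt0) // ln_ge0 //.
by rewrite ler_pdivlMr // mul1r.
Qed.

(** Follows from ln t < t at t = b / a. *)
Lemma mul_log2_div_le a b : 0 <= a -> a <= b -> a * log2 (b / a) <= b / ln 2.
Proof.
rewrite le_eqVlt => /predU1P[<- b0|a0 ab].
  by rewrite mul0r divr_ge0 // ltW // ln2_gt0.
rewrite /log2 mulrA ler_pM2r ?invr_gt0 ?ln2_gt0 //.
have b0 := lt_le_trans a0 ab.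
rewrite -ler_pdivlMl // [leRHS]mulrC.
by rewrite ltW // ln_sublinear // divr_gt0.
Qed.

Lemma xlog_le0 x : 0 <= x <= 1 -> xlog x <= 0.
Proof.
case/andP=> x0 x1; rewrite -oppr_ge0.
have := mul_log2_div_ge0 x0 x1.
by rewrite mul_log2_div_inv // /log2 ln1 mul0r mulr0 add0r.
Qed.

Lemma xlog_ge x : 0 <= x <= 1 -> - xlog x <= (ln 2)^-1.
Proof.
case/andP=> x0 x1; have := mul_log2_div_le x0 x1.
by rewrite mul_log2_div_inv // /log2 ln1 mul0r mulr0 add0r mul1r.
Qed.

End xlog.

(** * Entropy of pmfs on finite sets *)

Section dist_entropy.
Context {R : realType} {T : finType}.
Implicit Type p : dist R T.

Lemma dist_le1 p t : p t <= 1.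
Proof.
rewrite -(dist_sum1 p) (bigD1 t) //= lerDl sumr_ge0 // => *; exact: dist_ge0.
Qed.

Lemma entropyE (f : T -> R) : entropy f = - \sum_t xlog (f t).
Proof. by []. Qed.

Lemma entropy_ge0 p : 0 <= entropy p.
Proof.
rewrite entropyE -sumrN sumr_ge0 // => t _.
by rewrite oppr_ge0 xlog_le0 // dist_ge0 dist_le1.
Qed.

Lemma entropy_le p : entropy p <= #|T|%:R / ln 2.
Proof.
rewrite entropyE -sumrN mulr_natl -sumr_const ler_sum // => t _.
by rewrite xlog_ge // dist_ge0 dist_le1.
Qed.

(** Chain rule in its basic form: with [r] the probability of a past and [p] the conditional pmf of
    the next variable, summing that variable out brings out its conditional entropy. *)
Lemma sum_xlogM (r : R) p : 0 <= r -> \sum_t xlog (r * p t) = xlog r - r * entropy p.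
Proof.
move=> r0; rewrite entropyE mulrN opprK.
under eq_bigr do rewrite xlogM ?dist_ge0 //.
by rewrite big_split /= -mulr_suml -mulr_sumr dist_sum1 mul1r.
Qed.

Lemma entropy_dirac (a : T) : entropy (dirac_dist R a) = 0.
Proof.
rewrite entropyE big1 ?oppr0 // => t _ /=.
by case: (t == a); rewrite ?xlog0 // /xlog /log2 ln1 mul0r mulr0.
Qed.

Lemma dist_orE (f : T -> R) p : is_pmf f -> dist_or f p = f :> (T -> R).
Proof. by move=> h; rewrite /dist_or; case: pselect. Qed.

Lemma sum_dirac (a : T) (f : T -> R) : \sum_t dirac_dist R a t * f t = f a.
Proof.
rewrite (bigD1 a) //= eqxx mul1r big1 ?addr0 // => t /negbTE ->.
by rewrite mul0r.
Qed.

End dist_entropy.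

(** * One step of the filter *)

Section one_step.
Context {R : realType} {X U Y : finType}.
Variable M : pomdp R X U Y.
Implicit Types (pi : dist R X) (u : U) (y : Y) (x z : X).

(** p(X_{k+1} = x | pi_k = pi, U_k = u) *)
Definition predict pi u x : R := \sum_z trans M u z x * pi z.

Lemma predict_ge0 pi u x : 0 <= predict pi u x.
Proof. by apply: sumr_ge0 => z _; rewrite mulr_ge0 ?dist_ge0. Qed.

Lemma sum_predict pi u : \sum_x predict pi u x = 1.
Proof.
rewrite exchange_big /= -(dist_sum1 pi); apply: eq_bigr => z _.
by rewrite -mulr_suml dist_sum1 mul1r.
Qed.

Lemma predict_le1 pi u x : predict pi u x <= 1.
Proof.
rewrite -(sum_predict pi u) (bigD1 x) //= lerDl sumr_ge0 // => *.
exact: predict_ge0.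
Qed.

Lemma next_obsE pi u y : next_obs M pi u y = \sum_x obs M u x y * predict pi u x.
Proof.
apply: eq_bigr => x _; rewrite mulr_sumr.
by apply: eq_bigr => z _; rewrite mulrA.
Qed.

(** Bayes' rule is stated without division. If the normalizer is zero, each of its nonnegative terms
    vanishes, so the default value chosen by [dist_or] does not matter. *)
Lemma bayesP pi u y x :
  next_obs M pi u y * bayes M pi u y x = obs M u x y * predict pi u x.
Proof.
have ge0 z : 0 <= obs M u z y * predict pi u z.
  by rewrite mulr_ge0 ?dist_ge0 ?predict_ge0.
have [N0|N0] := eqVneq (next_obs M pi u y) 0.
  rewrite N0 mul0r; apply/esym/eqP.
  move: N0; rewrite next_obsE => /eqP; rewrite psumr_eq0 // => /allP/(_ x).
  by rewrite mem_index_enum => /(_ isT)/implyP; apply.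
rewrite /bayes dist_orE; first by rewrite mulrCA divff // mulr1.
split=> [t|]; first by rewrite divr_ge0 ?(dist_ge0 (next_obs M pi u)) ?ge0.
by rewrite -mulr_suml -next_obsE divff.
Qed.

Lemma init_beliefP y x :
  obs0_pmf M y * init_belief M y x = init M x * obs0 M x y.
Proof.
have ge0 z : 0 <= obs0 M z y * init M z by rewrite mulr_ge0 ?dist_ge0.
rewrite [RHS]mulrC.
have [N0|N0] := eqVneq (obs0_pmf M y) 0.
  rewrite N0 mul0r; apply/esym/eqP.
  move: N0; rewrite /obs0_pmf => /eqP; rewrite psumr_eq0 // => /allP/(_ x).
  by rewrite mem_index_enum => /(_ isT)/implyP; apply.
rewrite /init_belief dist_orE; first by rewrite mulrCA divff // mulr1.
split=> [t|]; first by rewrite divr_ge0 ?ge0 // sumr_ge0.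
by rewrite -mulr_suml divff.
Qed.

Lemma obs0_pmf_ge0 y : 0 <= obs0_pmf M y.
Proof. by apply: sumr_ge0 => x _; rewrite mulr_ge0 ?dist_ge0. Qed.

Lemma sum_obs0_pmf : \sum_y obs0_pmf M y = 1.
Proof.
rewrite exchange_big /= -(dist_sum1 (init M)); apply: eq_bigr => z _.
by rewrite -mulr_suml dist_sum1 mul1r.
Qed.

Lemma le_predict pi u z x : trans M u z x * pi z <= predict pi u x.
Proof.
by rewrite /predict (bigD1 z) //= lerDl sumr_ge0 // => *; rewrite mulr_ge0 ?dist_ge0.
Qed.

(** The common denominator leaves the inner sum. In this form [G2] is visibly the entropy of X_k
    given X_{k+1}, under pi_k = [pi] and U_k = [u]. *)
Lemma G2E pi u : G2 M pi u = \sum_x \sum_z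
  trans M u z x * pi z * log2 (predict pi u x / (trans M u z x * pi z)).
Proof.
by apply: eq_bigr => x _; apply: eq_bigr => z _; rewrite /predict mulr_suml.
Qed.

Lemma G2_ge0 pi u : 0 <= G2 M pi u.
Proof.
rewrite G2E; apply: sumr_ge0 => x _; apply: sumr_ge0 => z _.
by rewrite mul_log2_div_ge0 ?le_predict // mulr_ge0 ?dist_ge0.
Qed.

Lemma G2_le pi u : G2 M pi u <= #|X|%:R * #|X|%:R / ln 2.
Proof.
rewrite G2E -mulrA mulr_natl -sumr_const; apply: ler_sum => x _.
rewrite mulr_natl -sumr_const; apply: ler_sum => z _.
apply: le_trans (mul_log2_div_le _ (le_predict _ _ _ _)) _.
  by rewrite mulr_ge0 ?dist_ge0.
by rewrite -[leRHS]mul1r ler_pM2r ?invr_gt0 ?ln2_gt0 // predict_le1.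
Qed.

(** This is H(X_k, X_{k+1}) - H(X_{k+1}), with both entropies written through [xlog]. *)
Lemma G2_xlog pi u : G2 M pi u =
  \sum_x xlog (predict pi u x) - \sum_x \sum_z xlog (trans M u z x * pi z).
Proof.
rewrite G2E -sumrB; apply: eq_bigr => x _.
have -> : xlog (predict pi u x) =
    \sum_z trans M u z x * pi z * log2 (predict pi u x).
  by rewrite -mulr_suml.
rewrite -sumrB; apply: eq_bigr => z _.
by rewrite mul_log2_div_inv ?le_predict // mulr_ge0 ?dist_ge0.
Qed.

(** H(X_{k+1} | X_k) and H(Y_{k+1} | X_{k+1}) given pi_k = pi, U_k = u *)
Definition trans_entropy pi u : R := \sum_z pi z * entropy (trans M u z).
Definition obs_entropy pi u : R := \sum_x predict pi u x * entropy (obs M u x).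

(* Both sides are H(X_k, X_{k+1}, Y_{k+1} | pi_k, U_k), expanded along the chain
   X_k, X_{k+1}, Y_{k+1} on the left and Y_{k+1}, X_{k+1}, X_k on the right. *)
Lemma step_chain_rule pi u :
  G1 pi + trans_entropy pi u + obs_entropy pi u =
  G3 M pi u + \sum_y next_obs M pi u y * G1 (bayes M pi u y) + G2 M pi u.
Proof.
have E1 : \sum_x \sum_z xlog (trans M u z x * pi z) =
    - G1 pi - trans_entropy pi u.
  rewrite exchange_big /= /G1 entropyE opprK /trans_entropy -sumrB.
  apply: eq_bigr => z _; rewrite -sum_xlogM ?dist_ge0 //.
  by apply: eq_bigr => x _; rewrite mulrC.
have E2 : \sum_x \sum_y xlog (obs M u x y * predict pi u x) =
    \sum_x xlog (predict pi u x) - obs_entropy pi u.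
  rewrite /obs_entropy -sumrB; apply: eq_bigr => x _.
  by rewrite -sum_xlogM ?predict_ge0 //; apply: eq_bigr => y _; rewrite mulrC.
have E3 : \sum_x \sum_y xlog (obs M u x y * predict pi u x) =
    - G3 M pi u - \sum_y next_obs M pi u y * G1 (bayes M pi u y).
  rewrite exchange_big /= /G3 entropyE opprK -sumrB; apply: eq_bigr => y _.
  by rewrite -sum_xlogM ?dist_ge0 //; apply: eq_bigr => x _; rewrite bayesP.
rewrite G2_xlog; lra.
Qed.

End one_step.

(** * Sums over tuples, split at the first or last entry *)

Section tuple_sums.
Variables (V : nmodType) (A : finType).

Lemma big_tuple0 (F : 0.-tuple A -> V) : \sum_t F t = F [tuple].
Proof. by rewrite (big_pred1 [tuple]) // => t; rewrite (tuple0 t) /= eqxx. Qed.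

Lemma big_tuple_rcons n (F : n.+1.-tuple A -> V) :
  \sum_t F t = \sum_t \sum_a F (rcons_tuple t a).
Proof.
rewrite pair_bigA /= (reindex (fun p : n.-tuple A * A => rcons_tuple p.1 p.2)) //.
apply/onW_bij/inj_card_bij => [[s a] [t b] /(congr1 val)/= /rcons_inj[/val_inj-> ->] //|].
by rewrite card_prod !card_tuple expnS mulnC.
Qed.

Lemma big_tuple_cons n (F : n.+1.-tuple A -> V) :
  \sum_t F t = \sum_a \sum_t F (cons_tuple a t).
Proof.
rewrite pair_bigA /= (reindex (fun p : A * n.-tuple A => cons_tuple p.1 p.2)) //.
apply/onW_bij/inj_card_bij => [[a s] [b t] /(congr1 val)/= [-> /val_inj->] //|].
by rewrite card_prod !card_tuple expnS.
Qed.

End tuple_sums.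

(** Indices are compared as natural numbers, so that the lemma applies alike to [widen_ord], [lift]
    and [ord_max]. *)
Lemma tnth_rcons_lt (A : Type) n (t : n.-tuple A) a (i : 'I_n.+1) (j : 'I_n) :
  i = j :> nat -> tnth (rcons_tuple t a) i = tnth t j.
Proof. by move=> ij; rewrite !(tnth_nth a) /= nth_rcons size_tuple ij ltn_ord. Qed.

Lemma tnth_rcons_last (A : Type) n (t : n.-tuple A) a (i : 'I_n.+1) :
  i = n :> nat -> tnth (rcons_tuple t a) i = a.
Proof. by move=> iE; rewrite (tnth_nth a) /= nth_rcons size_tuple iE ltnn eqxx. Qed.

Lemma tuple_rcons_ex (A : Type) n (t : n.+1.-tuple A) :
  exists t' a, t = rcons_tuple t' a.
Proof.
case/tupleP: t => a t; exists (belast_tuple a t), (last a t).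
by apply: val_inj; rewrite /= lastI.
Qed.

Lemma take_rcons_le (A : Type) n (s : seq A) a :
  (n <= size s)%N -> take n (rcons s a) = take n s.
Proof. by move=> h; rewrite -cats1 takel_cat. Qed.

(** * Trajectories *)

Section trajectories.
Context {R : realType} {X U Y : finType}.
Variables (M : pomdp R X U Y) (mu : policy R U Y).

Lemma traj_pmf_rcons T (x : T.+1.-tuple X) (y : T.+1.-tuple Y) (u : T.-tuple U)
    z b a :
  traj_pmf M mu (rcons_tuple x z) (rcons_tuple y b) (rcons_tuple u a) =
  traj_pmf M mu x y u *
    (trans M a (tnth x ord_max) z * mu y u a * obs M a z b).
Proof.
rewrite /traj_pmf big_ord_recr /= mulrA; congr (_ * _ * (_ * _ * _)).
- by rewrite !(@tnth_rcons_lt _ _ _ _ ord0 ord0).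
- apply: eq_bigr => k _.
  rewrite (@tnth_rcons_lt _ _ u a _ k) //.
  rewrite (@tnth_rcons_lt _ _ x z _ (widen_ord (leqnSn T) k)) //.
  rewrite (@tnth_rcons_lt _ _ x z _ (lift ord0 k)) //.
  rewrite (@tnth_rcons_lt _ _ y b _ (lift ord0 k)) //.
  (* For k < T the policy reads prefixes that stop before the appended entries. *)
  by rewrite !take_rcons_le // size_tuple ?ltnS ltnW.
- rewrite (@tnth_rcons_last _ _ u a) //.
  rewrite (@tnth_rcons_lt _ _ x z (widen_ord _ _) ord_max) //.
  by rewrite (@tnth_rcons_last _ _ x z).
(* For k = T these prefixes are the whole of [y] and [u]. *)
- rewrite (@tnth_rcons_last _ _ u a) // !take_rcons_le ?size_tuple //.
  by rewrite !take_oversize ?size_tuple.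
- rewrite (@tnth_rcons_last _ _ u a) // (@tnth_rcons_last _ _ x z) //.
  by rewrite (@tnth_rcons_last _ _ y b).
Qed.

Lemma traj_pmf0 z b :
  traj_pmf M mu (rcons_tuple [tuple] z) (rcons_tuple [tuple] b) [tuple] =
  init M z * obs0 M z b.
Proof. by rewrite /traj_pmf big_ord0 mulr1 !tnth_rcons_last. Qed.

Lemma traj_pmf_ge0 T x y u : 0 <= @traj_pmf _ _ _ _ M mu T x y u.
Proof.
rewrite /traj_pmf !mulr_ge0 ?dist_ge0 // prodr_ge0 // => k _.
by rewrite !mulr_ge0 ?dist_ge0.
Qed.

Lemma io_pmf_ge0 T y u : 0 <= @io_pmf _ _ _ _ M mu T y u.
Proof. by apply: sumr_ge0 => x _; exact: traj_pmf_ge0. Qed.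

Lemma traj_le_io T x y u : @traj_pmf _ _ _ _ M mu T x y u <= io_pmf M mu y u.
Proof.
rewrite /io_pmf (bigD1 x) //= lerDl sumr_ge0 // => *; exact: traj_pmf_ge0.
Qed.

Lemma filter_belief_rcons T (y : T.+1.-tuple Y) (u : T.-tuple U) b a :
  filter_belief M (rcons y b) (rcons u a) = bayes M (filter_belief M y u) a b.
Proof.
case/tupleP: y => y0 y /=.
by rewrite zip_rcons ?size_tuple // foldl_rcons.
Qed.

(** The belief is the conditional law of X_T given I_T, tested against functions [f] and multiplied
    by p(I_T), which keeps null information states harmless. It is named because the inductive step
    uses it before it is proved. *)
Definition is_filter T := forall (y : T.+1.-tuple Y) (u : T.-tuple U) (f : X -> R),
  \sum_x traj_pmf M mu x y u * f (tnth x ord_max) =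
  io_pmf M mu y u * \sum_x filter_belief M y u x * f x.

Lemma sum_traj_rcons T (y : T.+1.-tuple Y) (u : T.-tuple U) b a (f : X -> R) :
  is_filter T ->
  \sum_x traj_pmf M mu x (rcons_tuple y b) (rcons_tuple u a) * f (tnth x ord_max) =
  io_pmf M mu y u * mu y u a * next_obs M (filter_belief M y u) a b *
  \sum_x filter_belief M (rcons y b) (rcons u a) x * f x.
Proof.
move=> IH; rewrite big_tuple_rcons exchange_big mulr_sumr /=.
apply: eq_bigr => z _; rewrite filter_belief_rcons.
rewrite [RHS]mulrA -[X in X * f z]mulrA bayesP.
under eq_bigr do rewrite traj_pmf_rcons tnth_rcons_last //.
transitivity (mu y u a * obs M a z b * f z *
  \sum_x traj_pmf M mu x y u * trans M a (tnth x ord_max) z).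
  by rewrite mulr_sumr; apply: eq_bigr => x _; ring.
(* Testing the belief at time T against the transition probability into [z] produces the
   prediction. *)
rewrite (IH y u (fun w => trans M a w z)) /predict.
under eq_bigr do rewrite mulrC.
ring.
Qed.

Lemma io_pmf_sum T (y : T.+1.-tuple Y) (u : T.-tuple U) :
  io_pmf M mu y u = \sum_x traj_pmf M mu x y u * 1.
Proof. by apply: eq_bigr => x _; rewrite mulr1. Qed.

Lemma io_pmf_rcons_filter T (y : T.+1.-tuple Y) (u : T.-tuple U) b a :
  is_filter T ->
  io_pmf M mu (rcons_tuple y b) (rcons_tuple u a) =
  io_pmf M mu y u * (mu y u a * next_obs M (filter_belief M y u) a b).
Proof.
move=> IH; rewrite io_pmf_sum.
transitivity (io_pmf M mu y u * mu y u a * next_obs M (filter_belief M y u) a b *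
    \sum_x filter_belief M (rcons y b) (rcons u a) x * 1).
  exact: sum_traj_rcons y u b a (fun=> 1) IH.
by under eq_bigr do rewrite mulr1; rewrite dist_sum1 mulr1 mulrA.
Qed.

(** By induction on T: Bayes' rule for Y_0, then one filter update for each control and
    observation. *)
Lemma filter_beliefP T : is_filter T.
Proof.
elim: T => [|T IH] y u f.
  case/tupleP: y => y0 y; rewrite (tuple0 y) (tuple0 u) {y u}.
  have -> : [tuple of y0 :: [tuple]] = rcons_tuple [tuple] y0 by exact: val_inj.
  have sumE (g : X -> R) :
      \sum_x traj_pmf M mu x (rcons_tuple [tuple] y0) [tuple] * g (tnth x ord_max) =
      obs0_pmf M y0 * \sum_x init_belief M y0 x * g x.
    rewrite big_tuple_rcons big_tuple0 mulr_sumr; apply: eq_bigr => z _.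
    by rewrite traj_pmf0 tnth_rcons_last // mulrA init_beliefP.
  (* The constant test function identifies the weight of the information state. *)
  have /= E1 := sumE (fun=> 1).
  rewrite sumE io_pmf_sum E1; congr (_ * _).
  by under eq_bigr do rewrite mulr1; rewrite dist_sum1 mulr1.
have [y' [b ->]] := tuple_rcons_ex y; have [u' [a ->]] := tuple_rcons_ex u.
by rewrite sum_traj_rcons // io_pmf_rcons_filter // mulrA.
Qed.

Lemma io_pmf_rcons T (y : T.+1.-tuple Y) (u : T.-tuple U) b a :
  io_pmf M mu (rcons_tuple y b) (rcons_tuple u a) =
  io_pmf M mu y u * (mu y u a * next_obs M (filter_belief M y u) a b).
Proof.
exact: io_pmf_rcons_filter (@filter_beliefP T).
Qed.

Lemma io_pmf0 b : io_pmf M mu (rcons_tuple [tuple] b) [tuple] = obs0_pmf M b.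
Proof.
rewrite /io_pmf big_tuple_rcons big_tuple0; apply: eq_bigr => z _.
by rewrite traj_pmf0 mulrC.
Qed.

(** The expectation of a function of I_T. Taking [f] on sequences lets one function serve all
    horizons. *)
Definition info_exp T (f : seq Y -> seq U -> R) : R :=
  \sum_(y : T.+1.-tuple Y) \sum_(u : T.-tuple U) io_pmf M mu y u * f y u.

Lemma info_exp0 f : info_exp 0 f = \sum_y obs0_pmf M y * f [:: y] [::].
Proof.
rewrite /info_exp big_tuple_rcons big_tuple0; apply: eq_bigr => b _.
by rewrite big_tuple0 io_pmf0.
Qed.

(** E[f(I_{T+1}) | I_T = (ys, us)] *)
Definition step_exp (f : seq Y -> seq U -> R) (ys : seq Y) (us : seq U) : R :=
  \sum_a mu ys us a * \sum_b next_obs M (filter_belief M ys us) a b *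
    f (rcons ys b) (rcons us a).

Lemma exchange_rcons T (F : T.+2.-tuple Y -> T.+1.-tuple U -> R) :
  \sum_y \sum_u F y u = \sum_y \sum_u \sum_a \sum_b
     F (rcons_tuple y b) (rcons_tuple u a).
Proof.
rewrite big_tuple_rcons; apply: eq_bigr => y _.
under eq_bigr do rewrite big_tuple_rcons.
rewrite exchange_big /=; apply: eq_bigr => u _.
by rewrite exchange_big.
Qed.

(** The tower property over the last control and observation. *)
Lemma info_expS T f : info_exp T.+1 f = info_exp T (step_exp f).
Proof.
rewrite /info_exp exchange_rcons; apply: eq_bigr => y _; apply: eq_bigr => u _.
rewrite /step_exp mulr_sumr; apply: eq_bigr => a _.
rewrite 2!mulr_sumr; apply: eq_bigr => b _.
by rewrite io_pmf_rcons; ring.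
Qed.

Lemma info_exp_le T (f g : seq Y -> seq U -> R) :
  (forall (y : T.+1.-tuple Y) (u : T.-tuple U), f y u <= g y u) ->
  info_exp T f <= info_exp T g.
Proof.
move=> fg; apply: ler_sum => y _; apply: ler_sum => u _.
by rewrite ler_wpM2l ?io_pmf_ge0.
Qed.

Lemma eq_info_exp T (f g : seq Y -> seq U -> R) :
  (forall (y : T.+1.-tuple Y) (u : T.-tuple U), f y u = g y u) ->
  info_exp T f = info_exp T g.
Proof. by move=> fg; apply: eq_bigr => y _; apply: eq_bigr => u _; rewrite fg. Qed.

Lemma info_expD T f g :
  info_exp T (fun y u => f y u + g y u) = info_exp T f + info_exp T g.
Proof.
rewrite /info_exp -big_split; apply: eq_bigr => y _ /=.
by rewrite -big_split; apply: eq_bigr => u _ /=; rewrite mulrDr.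
Qed.

Lemma info_expZ T r f :
  info_exp T (fun y u => r * f y u) = r * info_exp T f.
Proof.
rewrite /info_exp mulr_sumr; apply: eq_bigr => y _ /=.
by rewrite mulr_sumr; apply: eq_bigr => u _ /=; rewrite mulrCA.
Qed.

Lemma info_expB T f g :
  info_exp T (fun y u => f y u - g y u) = info_exp T f - info_exp T g.
Proof.
rewrite -[- info_exp T g]mulN1r -info_expZ -info_expD.
by apply: eq_info_exp => y u; rewrite mulN1r.
Qed.

(** By the tower property, starting from the law of Y_0; it expresses that [io_pmf] has total mass
    1. *)
Lemma info_exp_cst T r : info_exp T (fun _ _ => r) = r.
Proof.
elim: T => [|T IH].
  by rewrite info_exp0 -mulr_suml sum_obs0_pmf mul1r.
rewrite info_expS -[RHS]IH; apply: eq_info_exp => y u.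
rewrite /step_exp; under eq_bigr do rewrite -mulr_suml dist_sum1 mul1r.
by rewrite -mulr_suml dist_sum1 mul1r.
Qed.

(** The old trajectory stays outside and the new control, state and observation follow in causal
    order, so that the innermost sums can be eliminated one conditional pmf at a time. *)
Lemma traj_expS T (F : T.+2.-tuple X -> T.+2.-tuple Y -> T.+1.-tuple U -> R) :
  \sum_x \sum_y \sum_u F x y u = \sum_y \sum_u \sum_x \sum_a \sum_z \sum_b
     F (rcons_tuple x z) (rcons_tuple y b) (rcons_tuple u a).
Proof.
rewrite big_tuple_rcons; under eq_bigr => x _.
  under eq_bigr => z _ do rewrite exchange_rcons.
  rewrite exchange_big /=; under eq_bigr => y _.
    rewrite exchange_big /=; under eq_bigr => u _ do rewrite exchange_big /=.
    over.
  over.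
rewrite exchange_big /=; apply: eq_bigr => y _.
by rewrite exchange_big.
Qed.

Lemma traj_sum_last T (f : X -> seq Y -> seq U -> R) :
  \sum_(y : T.+1.-tuple Y) \sum_(u : T.-tuple U) \sum_x
     traj_pmf M mu x y u * f (tnth x ord_max) y u =
  info_exp T (fun ys us => \sum_x filter_belief M ys us x * f x ys us).
Proof.
apply: eq_bigr => y _; apply: eq_bigr => u _.
exact: (filter_beliefP y u (fun x => f x y u)).
Qed.

End trajectories.

(** * The regularized cost as a sum of stage costs *)

Section cost_recursion.
Context {R : realType} {X U Y : finType}.
Variables (M : pomdp R X U Y) (mu : policy R U Y).

Local Notation filter := (filter_belief M).

Lemma traj_exchange T (F : T.+1.-tuple X -> T.+1.-tuple Y -> T.-tuple U -> R) :
  \sum_x \sum_y \sum_u F x y u = \sum_y \sum_u \sum_x F x y u.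
Proof. by rewrite exchange_big; apply: eq_bigr => y _; exact: exchange_big. Qed.

(** The joint entropy H(X^T, Y^T, U^{T-1}). *)
Definition traj_entropy T : R :=
  - \sum_x \sum_y \sum_u xlog (@traj_pmf _ _ _ _ M mu T x y u).

Lemma io_entropyE T :
  io_entropy M mu T = - \sum_y \sum_u xlog (@io_pmf _ _ _ _ M mu T y u).
Proof.
rewrite /io_entropy /traj_expectation traj_exchange; congr (- _).
by apply: eq_bigr => y _; apply: eq_bigr => u _; rewrite -mulr_suml.
Qed.

(** Chain rule: the conditional entropy is the joint entropy minus that of the conditioning
    variables. *)
Lemma smoother_entropyE T :
  smoother_entropy M mu T = traj_entropy T - io_entropy M mu T.
Proof.
rewrite /smoother_entropy /io_entropy /traj_entropy /traj_expectation opprK.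
rewrite -[X in _ + X]opprK -opprD -sumrB; congr (- _).
apply: eq_bigr => x _; rewrite -sumrB; apply: eq_bigr => y _.
rewrite -sumrB; apply: eq_bigr => u _.
by rewrite mul_log2_div ?traj_le_io ?traj_pmf_ge0.
Qed.

(** The increment is H(U_T | I_T) + H(Y_{T+1} | I_T, U_T), obtained by summing out the observation
    and then the control. *)
Lemma io_entropyS T : io_entropy M mu T.+1 = io_entropy M mu T +
  info_exp M mu T (fun y u =>
    entropy (mu y u) + \sum_a mu y u a * G3 M (filter y u) a).
Proof.
rewrite !io_entropyE exchange_rcons /info_exp.
rewrite -[X in _ + X]opprK -opprD -sumrB; congr (- _); apply: eq_bigr => y _.
rewrite -sumrB; apply: eq_bigr => u _.
set p := io_pmf M mu y u; set m := mu y u.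
have p0 : 0 <= p by exact: io_pmf_ge0.
transitivity (\sum_a (xlog (p * m a) - p * m a * G3 M (filter y u) a)).
  apply: eq_bigr => a _; rewrite -sum_xlogM ?mulr_ge0 // ?dist_ge0 //.
  by apply: eq_bigr => b _; rewrite io_pmf_rcons mulrA.
rewrite sumrB sum_xlogM // mulrDr mulr_sumr opprD addrA.
by under [in RHS]eq_bigr do rewrite mulrA.
Qed.

(** Given the past trajectory, the chain rule is applied to U_T, then X_{T+1}, then Y_{T+1}; the
    filter then averages over X_T. *)
Lemma traj_entropyS T : traj_entropy T.+1 = traj_entropy T +
  info_exp M mu T (fun y u => entropy (mu y u) +
    \sum_a mu y u a *
      (trans_entropy M (filter y u) a + obs_entropy M (filter y u) a)).
Proof.
(* Entropy of (X_{T+1}, Y_{T+1}) given X_T = [w] and U_T = [a]. *)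
pose h w a := entropy (trans M a w) + \sum_z trans M a w z * entropy (obs M a z).
have -> : info_exp M mu T (fun y u => entropy (mu y u) + \sum_a mu y u a *
      (trans_entropy M (filter y u) a + obs_entropy M (filter y u) a)) =
    info_exp M mu T (fun y u => \sum_x filter y u x *
      (entropy (mu y u) + \sum_a mu y u a * h x a)).
  apply: eq_info_exp => y u; under [RHS]eq_bigr do rewrite mulrDr.
  rewrite big_split /= -mulr_suml dist_sum1 mul1r; congr (_ + _).
  under [RHS]eq_bigr do rewrite mulr_sumr.
  rewrite exchange_big /=; apply: eq_bigr => a _.
  rewrite /trans_entropy /obs_entropy /predict.
  under [X in _ * (_ + X)]eq_bigr do rewrite mulr_suml.
  rewrite exchange_big -big_split /= mulr_sumr; apply: eq_bigr => x _.
  rewrite [RHS]mulrCA; congr (_ * _); rewrite /h mulrDr; congr (_ + _).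
  by rewrite mulr_sumr; apply: eq_bigr => z _; ring.
rewrite -(traj_sum_last M mu T (fun x y u => entropy (mu y u) + \sum_a mu y u a * h x a)).
rewrite /traj_entropy traj_expS traj_exchange.
rewrite -[X in _ + X]opprK -opprD -sumrB; congr (- _); apply: eq_bigr => y _.
rewrite -sumrB; apply: eq_bigr => u _; rewrite -sumrB; apply: eq_bigr => x _.
set p := traj_pmf M mu x y u; set m := mu y u; set w := tnth x ord_max.
have p0 : 0 <= p by exact: traj_pmf_ge0.
transitivity (\sum_a (xlog (p * m a) - p * m a * h w a)).
  apply: eq_bigr => a _; have pm0 : 0 <= p * m a by rewrite mulr_ge0 ?dist_ge0.
  transitivity (\sum_z (xlog (p * m a * trans M a w z) -
      p * m a * trans M a w z * entropy (obs M a z))).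
    apply: eq_bigr => z _; rewrite -sum_xlogM; last exact: mulr_ge0 (dist_ge0 _ _).
    apply: eq_bigr => b _; rewrite traj_pmf_rcons; congr xlog.
    by rewrite -/p -/m -/w; ring.
  rewrite sumrB sum_xlogM // /h mulrDr opprD addrA mulr_sumr.
  by under [in RHS]eq_bigr do rewrite mulrA.
rewrite sumrB sum_xlogM // mulrDr mulr_sumr opprD addrA.
by under [in RHS]eq_bigr do rewrite mulrA.
Qed.

Lemma io_entropy0 : io_entropy M mu 0 = entropy (obs0_pmf M).
Proof.
rewrite io_entropyE entropyE big_tuple_rcons big_tuple0; congr (- _).
by apply: eq_bigr => b _; rewrite big_tuple0 io_pmf0.
Qed.

Lemma smoother_entropy0 :
  smoother_entropy M mu 0 = info_exp M mu 0 (fun y u => G1 (filter y u)).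
Proof.
rewrite smoother_entropyE io_entropy0 entropyE info_exp0 opprK /traj_entropy.
rewrite traj_exchange big_tuple_rcons big_tuple0 addrC -sumrB.
apply: eq_bigr => b _; rewrite big_tuple0 big_tuple_rcons big_tuple0 /= /G1 entropyE.
under eq_bigr do rewrite traj_pmf0 -init_beliefP.
by rewrite sum_xlogM ?obs0_pmf_ge0 // entropyE; ring.
Qed.

(** The entropy of the randomization of U_T enters both the joint and the input-output entropy and
    cancels. [step_chain_rule] converts the rest into [G2] and the change in [G1]. *)
Lemma smoother_entropyS T : smoother_entropy M mu T.+1 = smoother_entropy M mu T +
  (info_exp M mu T.+1 (fun y u => G1 (filter y u)) -
   info_exp M mu T (fun y u => G1 (filter y u)) +
   info_exp M mu T (fun y u => \sum_a mu y u a * G2 M (filter y u) a)).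
Proof.
rewrite smoother_entropyE traj_entropyS io_entropyS opprD addrACA -smoother_entropyE.
congr (_ + _); rewrite -info_expB info_expS.
have -> : info_exp M mu T (step_exp M mu (fun y u => G1 (filter y u))) =
   info_exp M mu T (fun y u => \sum_a mu y u a *
     \sum_b next_obs M (filter y u) a b * G1 (bayes M (filter y u) a b)).
  apply: eq_info_exp => y u; apply: eq_bigr => a _; congr (_ * _).
  by apply: eq_bigr => b _; rewrite filter_belief_rcons.
rewrite -info_expB -info_expD; apply: eq_info_exp => y u.
rewrite opprD addrACA subrr add0r -sumrB.
(* Spreading the [G1] term over the controls reduces the identity to one control at a time. *)
rewrite -[X in _ - X + _]mul1r -(dist_sum1 (mu y u)) mulr_suml -sumrB -big_split /=.
apply: eq_bigr => a _.
have := congr1 ( *%R (mu y u a)) (step_chain_rule M (filter y u) a); lra.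
Qed.

Lemma smoother_entropy_sum T : smoother_entropy M mu T =
  info_exp M mu T (fun y u => G1 (filter y u)) +
  \sum_(k < T) info_exp M mu k (fun y u => \sum_a mu y u a * G2 M (filter y u) a).
Proof.
elim: T => [|T IH]; first by rewrite big_ord0 addr0 smoother_entropy0.
rewrite smoother_entropyS IH big_ord_recr /=; ring.
Qed.

Lemma io_entropy_sum T : io_entropy M mu T = entropy (obs0_pmf M) +
  \sum_(k < T) info_exp M mu k (fun y u =>
    entropy (mu y u) + \sum_a mu y u a * G3 M (filter y u) a).
Proof.
elim: T => [|T IH]; first by rewrite big_ord0 addr0 io_entropy0.
by rewrite io_entropyS IH big_ord_recr addrA.
Qed.

(** The terminal term is a function of X_T, which the filter averages; the running cost is treated
    by induction on T. *)
Lemma total_cost_sum c cT T : total_cost M c cT mu T =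
  info_exp M mu T (fun y u => \sum_x filter y u x * cT x) +
  \sum_(k < T) info_exp M mu k (fun y u =>
    \sum_a mu y u a * \sum_x filter y u x * c x a).
Proof.
pose C T (x : T.+1.-tuple X) (u : T.-tuple U) : R :=
  \sum_(k < T) c (tnth x (widen_ord (leqnSn T) k)) (tnth u k).
pose RC T := \sum_x \sum_y \sum_u traj_pmf M mu x y u * C T x u.
have -> : total_cost M c cT mu T =
    info_exp M mu T (fun y u => \sum_x filter y u x * cT x) + RC T.
  rewrite -(traj_sum_last M mu T (fun x _ _ => cT x)) -traj_exchange -big_split.
  apply: eq_bigr => x _; rewrite -big_split; apply: eq_bigr => y _.
  by rewrite -big_split; apply: eq_bigr => u _; rewrite /= -mulrDr.
congr (_ + _); elim: T => [|T IH].
  rewrite big_ord0 /RC big1 // => x _; rewrite big1 // => y _; rewrite big1 // => u _.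
  by rewrite /C big_ord0 mulr0.
rewrite big_ord_recr /= -IH /RC traj_expS.
have -> : info_exp M mu T (fun y u => \sum_a mu y u a * \sum_x filter y u x * c x a)
    = info_exp M mu T (fun y u => \sum_x filter y u x * \sum_a mu y u a * c x a).
  apply: eq_info_exp => y u; under eq_bigr do rewrite mulr_sumr.
  rewrite exchange_big /=; apply: eq_bigr => x _; rewrite mulr_sumr.
  by apply: eq_bigr => a _; rewrite mulrCA.
rewrite -(traj_sum_last M mu T (fun x y u => \sum_a mu y u a * c x a)) traj_exchange.
rewrite -big_split; apply: eq_bigr => y _; rewrite -big_split; apply: eq_bigr => u _ /=.
rewrite -big_split; apply: eq_bigr => x _ /=.
transitivity (\sum_a traj_pmf M mu x y u * (mu y u a *
    (C T x u + c (tnth x ord_max) a))).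
  apply: eq_bigr => a _.
  have CS z : C T.+1 (rcons_tuple x z) (rcons_tuple u a) =
      C T x u + c (tnth x ord_max) a.
    rewrite /C big_ord_recr /=; congr (_ + c _ _).
    - apply: eq_bigr => k _; congr (c _ _); last exact: tnth_rcons_lt.
      exact: tnth_rcons_lt.
    - exact: tnth_rcons_lt.
    - exact: tnth_rcons_last.
  (* The running cost does not involve X_{T+1} or Y_{T+1}, so both sum out. *)
  transitivity (\sum_z trans M a (tnth x ord_max) z *
      (traj_pmf M mu x y u * (mu y u a * (C T x u + c (tnth x ord_max) a)))).
    apply: eq_bigr => z _.
    under eq_bigr do rewrite traj_pmf_rcons CS.
    rewrite -mulr_suml -!mulr_sumr dist_sum1; ring.
  by rewrite -mulr_suml dist_sum1 mul1r.
rewrite -mulr_sumr -mulrDr; congr (_ * _).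
transitivity (\sum_a (mu y u a * C T x u + mu y u a * c (tnth x ord_max) a)).
  by apply: eq_bigr => a _; rewrite mulrDr.
by rewrite big_split /= -mulr_suml dist_sum1 mul1r.
Qed.

Variables (c : X -> U -> R) (cT : X -> R) (beta lambda : R).

Definition terminal_cost (pi : dist R X) : R :=
  \sum_x pi x * cT x + beta * G1 pi.

Definition stage_cost (pi : dist R X) (a : U) : R :=
  \sum_x pi x * c x a + beta * G2 M pi a + lambda * G3 M pi a.

(** The entropy of the randomization is kept outside [stage_cost], since it depends on the whole pmf
    [mu y u] and not on a belief and a control. *)
Lemma regularized_cost_sum T : regularized_cost M c cT beta lambda mu T =
  lambda * entropy (obs0_pmf M) +
  info_exp M mu T (fun y u => terminal_cost (filter y u)) +
  \sum_(k < T) info_exp M mu k (fun y u =>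
    \sum_a mu y u a * stage_cost (filter y u) a + lambda * entropy (mu y u)).
Proof.
rewrite /regularized_cost total_cost_sum smoother_entropy_sum io_entropy_sum.
rewrite /terminal_cost info_expD info_expZ !mulrDr !mulr_sumr.
set s1 := \sum_(k < T) _; set s2 := \sum_(k < T) _; set s3 := \sum_(k < T) _.
set s4 := \sum_(k < T) _.
suff -> : s4 = s1 + s2 + s3 by ring.
rewrite /s1 /s2 /s3 /s4 -!big_split /=; apply: eq_bigr => k _.
rewrite -!info_expZ -!info_expD; apply: eq_info_exp => y u.
rewrite mulrDr /stage_cost !mulr_sumr.
under eq_bigr do rewrite 2!mulrDr.
rewrite !big_split /= -!addrA; congr (_ + _).
have E (f : U -> R) r : \sum_a mu y u a * (r * f a) = \sum_a r * (mu y u a * f a).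
  by apply: eq_bigr => a _; rewrite mulrCA.
rewrite !E; ring.
Qed.

End cost_recursion.

(** * Geometric horizon *)

Section geometric_series.
Context {R : realType}.
Variable gamma : R.
Hypotheses (gamma_gt0 : 0 < gamma) (gamma_lt1 : gamma < 1).

Let gamma_ge0 : 0 <= gamma. Proof. exact: ltW. Qed.
Let gamma_abs : `|gamma| < 1. Proof. by rewrite gtr0_norm. Qed.

Definition discounted_sum (g : nat -> R) (n : nat) : R :=
  \sum_(0 <= k < n) gamma ^+ k * g k.

Lemma discounted_sumS g n :
  discounted_sum g n.+1 = discounted_sum g n + gamma ^+ n * g n.
Proof. by rewrite /discounted_sum big_nat_recr. Qed.

Lemma discounted_sum0 g : discounted_sum g 0 = 0.
Proof. by rewrite /discounted_sum big_geq. Qed.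

Lemma sum_gammaX_le n : discounted_sum (fun=> 1) n <= (1 - gamma)^-1.
Proof.
have := @geometric_le_lim R n 1 gamma ler01 gamma_gt0 gamma_abs.
rewrite mul1r; apply: le_trans; apply: ler_sum => k _.
by rewrite /geometric /= mulr1 mul1r.
Qed.

Lemma discounted_sum_le (g : nat -> R) (C : R) (n : nat) :
  (forall k, `|g k| <= C) -> `|discounted_sum g n| <= C / (1 - gamma).
Proof.
move=> gC; have C0 : 0 <= C by apply: le_trans (gC 0).
apply: (@le_trans _ _ (C * discounted_sum (fun=> 1) n)); last first.
  by rewrite ler_wpM2l // sum_gammaX_le.
apply: le_trans (ler_norm_sum _ _ _) _; rewrite mulr_sumr; apply: ler_sum => k _.
by rewrite normrM ger0_norm ?exprn_ge0 // mulr1 mulrC ler_wpM2r // exprn_ge0.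
Qed.

Lemma cvg_discounted_sum (g : nat -> R) (C : R) :
  (forall k, `|g k| <= C) -> cvgn (discounted_sum g).
Proof.
move=> gC; have C0 : 0 <= C by apply: le_trans (gC 0).
apply: (@normed_cvg _ R^o (fun k => gamma ^+ k * g k)).
apply: (@series_le_cvg _ _ (geometric C gamma)) => [n|n|n|].
- exact: normr_ge0.
- by rewrite /geometric /= mulr_ge0 // exprn_ge0.
- rewrite /geometric /= normrM ger0_norm ?exprn_ge0 // mulrC.
  by rewrite ler_wpM2r // exprn_ge0.
- exact: is_cvg_geometric_series.
Qed.

(** Partial sums of E[T + 1]. These weights matter because the regularized cost grows at most
    linearly in the horizon. *)
Lemma sum_geometric_weights n :
  \sum_(0 <= t < n) gamma ^+ t * (1 - gamma) * t.+1%:R =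
  discounted_sum (fun=> 1) n - n%:R * gamma ^+ n.
Proof.
elim: n => [|n IH]; first by rewrite discounted_sum0 big_geq // mul0r subr0.
by rewrite big_nat_recr //= IH discounted_sumS exprS -natr1; ring.
Qed.

Lemma geometric_weights_le n :
  \sum_(0 <= t < n) gamma ^+ t * (1 - gamma) * t.+1%:R <= (1 - gamma)^-1.
Proof.
rewrite sum_geometric_weights; apply: le_trans (sum_gammaX_le n).
by rewrite gerBl mulr_ge0 // exprn_ge0.
Qed.

Lemma geometric_weight_ge0 t : 0 <= gamma ^+ t * (1 - gamma) * t.+1%:R.
Proof. by rewrite !mulr_ge0 ?exprn_ge0 // subr_ge0 ltW. Qed.

Lemma cvg_geometric_weights :
  cvgn (fun n => \sum_(0 <= t < n) gamma ^+ t * (1 - gamma) * t.+1%:R).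
Proof.
apply: nondecreasing_is_cvgn.
  by apply: nondecreasing_series => n _ _; exact: geometric_weight_ge0.
by exists (1 - gamma)^-1 => _ [n _ <-]; exact: geometric_weights_le.
Qed.

(** The weights above are summable, hence tend to zero, and they dominate the sequence up to a
    constant. *)
Lemma cvg_mul_gammaX (u : nat -> R) (C : R) : (forall n, `|u n| <= C * n.+1%:R) ->
  (fun n => gamma ^+ n * u n) @ \oo --> (0 : R).
Proof.
move=> uC; apply/norm_cvg0P.
have w0 := cvg_series_cvg_0 cvg_geometric_weights.
have g1 : 0 < 1 - gamma by rewrite subr_gt0.
apply: (@squeeze_cvgr _ _ _ _ (cst 0)
  (fun n => C / (1 - gamma) * (gamma ^+ n * (1 - gamma) * n.+1%:R))).
- near=> n; rewrite normr_ge0 /= normrM ger0_norm ?exprn_ge0 //.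
  have -> : C / (1 - gamma) * (gamma ^+ n * (1 - gamma) * n.+1%:R) =
      gamma ^+ n * (C * n.+1%:R) by field; rewrite gt_eqF.
  by rewrite ler_wpM2l // exprn_ge0.
- exact: cvg_cst.
- by rewrite -[X in _ --> X](mulr0 (C / (1 - gamma))); exact: cvgMl_tmp.
Unshelve. all: by end_near.
Qed.

(* Summation by parts: the stage cost s k is paid when the horizon exceeds k,
   an event of probability gamma ^+ k.+1. *)
Lemma geometric_stopping_cvg (h C : R) (a s r : nat -> R) :
  (forall k, `|a k| <= C) -> (forall k, `|s k| <= C) ->
  (forall t, r t = h + a t + \sum_(k < t) s k) ->
  (fun n => \sum_(0 <= t < n) gamma ^+ t * (1 - gamma) * r t) @ \oo -->
  h + limn (discounted_sum (fun k => (1 - gamma) * a k + gamma * s k)).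
Proof.
move=> aC sC rE; set g := fun k => (1 - gamma) * a k + gamma * s k.
have -> : (fun n => \sum_(0 <= t < n) gamma ^+ t * (1 - gamma) * r t) =
    (fun n => h - gamma ^+ n * h + discounted_sum g n -
              gamma ^+ n * \sum_(k < n) s k).
  apply/funext; elim=> [|n IH].
    by rewrite big_geq // discounted_sum0 big_ord0 expr0; ring.
  rewrite big_nat_recr //= IH rE discounted_sumS big_ord_recr /= /g exprS; ring.
have -> : h + limn (discounted_sum g) = h - 0 + limn (discounted_sum g) - 0.
  by rewrite !subr0.
have C0 : 0 <= C by apply: le_trans (aC 0).
apply: cvgB; first apply: cvgD; first apply: cvgB.
- exact: cvg_cst.
- apply: (cvg_mul_gammaX (u := fun=> h) (C := `|h|)) => n.
  by rewrite ler_peMr // ler1n.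
- apply: (cvg_discounted_sum (C := C + C)) => k.
  apply: le_trans (ler_normD _ _) _; apply: lerD; rewrite normrM.
    by rewrite -[leRHS]mul1r ler_pM // ger0_norm ?gerBl // subr_ge0 ltW.
  by rewrite -[leRHS]mul1r ler_pM // ger0_norm // ltW.
- apply: (cvg_mul_gammaX (C := C)) => n.
  apply: le_trans (ler_norm_sum _ _ _) _.
  apply: (@le_trans _ _ (\sum_(k < n) C)); first exact: ler_sum.
  by rewrite sumr_const card_ord -[leLHS]mulr_natr ler_wpM2l // ler_nat.
Qed.

End geometric_series.

(** * Expectation of a function of an integer-valued random variable *)

Section expectation_nat.
Local Open Scope ereal_scope.
Context {R : realType} {d : measure_display} {Omega : measurableType d}.
Variables (P : probability Omega R) (T : {RV P >-> nat}) (p : nat -> R).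
Hypothesis Tp : forall t, P (T @^-1` [set t]) = (p t)%:E.

Let mT t : measurable (T @^-1` [set t]).
Proof. exact: measurable_funPTI. Qed.

Let tT : trivIset [set: nat] (fun t => T @^-1` [set t]).
Proof. by apply/trivIsetP => i j _ _ /eqP ij; apply/seteqP; split => // w [/= -> ]. Qed.

Let cT : \bigcup_t T @^-1` [set t] = [set: Omega].
Proof. by apply/seteqP; split => // w _; exists (T w). Qed.

Let measurable_fT (f : nat -> R) : measurable_fun [set: Omega] (fun w => f (T w)).
Proof. by apply: (measurableT_comp (f := f)). Qed.

Let int_fiber (f : nat -> R) t :
  \int[P]_(w in T @^-1` [set t]) (f (T w))%:E = (p t * f t)%:E.
Proof.
rewrite (eq_integral (cst (f t)%:E)) => [|w]; last by rewrite inE /= => ->.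
by rewrite integral_cst // muleC [X in X * _]Tp.
Qed.

(** The sample space is cut into the fibers of [T]. The bound [C] gives the integrability that
    countable additivity of the integral requires. *)
Lemma expectation_nat (f : nat -> R) (C l : R) :
  (forall n, \sum_(0 <= t < n) p t * `|f t| <= C)%R ->
  ((fun n => \sum_(0 <= t < n) p t * f t) @ \oo --> l)%R ->
  'E_P[fun w => f (T w)] = l%:E.
Proof.
move=> fC fl; rewrite unlock -cT integral_bigcup //.
  under eq_eseriesr do rewrite int_fiber.
  apply/cvg_lim => //; under eq_fun do rewrite sumEFin.
  by apply: cvg_EFin => //; exact: nearW.
rewrite cT; apply/integrableP; split; first exact/measurable_EFinP.
rewrite -cT ge0_integral_bigcup //; last first.
  by rewrite cT; apply: measurableT_comp => //; exact/measurable_EFinP.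
under eq_eseriesr do rewrite (int_fiber (fun t => `|f t|%R)).
apply: (@le_lt_trans _ _ C%:E); last exact: ltry.
apply: lime_le.
  apply: is_cvg_nneseries => n _ _; rewrite lee_fin mulr_ge0 //.
  by rewrite -lee_fin -Tp.
by apply: nearW => n; rewrite sumEFin lee_fin.
Qed.

End expectation_nat.

Lemma cvg_sumr (R : realType) (I : finType) (f : I -> nat -> R) (l : I -> R) :
  (forall i, f i @ \oo --> l i) ->
  (fun n => \sum_i f i n) @ \oo --> \sum_i l i.
Proof. by move=> fl; apply: cvg_big => //; exact: add_continuous. Qed.

(** * Recursive inequalities and discounted sums *)

Section discounted_recursion.
Context {R : realType}.
Variables (gamma C : R) (g e : nat -> R).
Hypotheses (gamma_gt0 : 0 < gamma) (gamma_lt1 : gamma < 1).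
Hypotheses (gC : forall k, `|g k| <= C) (eC : forall k, `|e k| <= C).

(** Unrolling the inequality n times leaves the remainder [gamma ^+ n * e n], which vanishes because
    [e] is bounded. *)
Lemma discounted_lower_bound : (forall k, e k <= g k + gamma * e k.+1) ->
  e 0 <= limn (discounted_sum gamma g).
Proof.
move=> ege.
have bound n : e 0 <= discounted_sum gamma g n + gamma ^+ n * e n.
  elim: n => [|n IH]; first by rewrite discounted_sum0 add0r mul1r.
  apply: le_trans IH _; rewrite discounted_sumS -addrA lerD2l exprSr -mulrA -mulrDr.
  by rewrite ler_wpM2l // exprn_ge0 // ltW.
have h : (fun n => discounted_sum gamma g n + gamma ^+ n * e n) @ \oo -->
    limn (discounted_sum gamma g) + 0.
  apply: cvgD; first exact: (cvg_discounted_sum gamma_gt0 gamma_lt1 gC).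
  apply: (cvg_mul_gammaX gamma_gt0 gamma_lt1 (C := C)) => n.
  by rewrite (le_trans (eC n)) // ler_peMr ?ler1n // (le_trans _ (eC 0)).
rewrite addr0 in h.
by apply: (ler_cvg_to (cvg_cst (e 0)) h); exact: nearW.
Qed.

End discounted_recursion.

(** The lower bound is applied to the sequences and to their opposites. *)
Lemma discounted_recursion (R : realType) (gamma C : R) (g e : nat -> R) :
  0 < gamma -> gamma < 1 ->
  (forall k, `|g k| <= C) -> (forall k, `|e k| <= C) ->
  (forall k, e k = g k + gamma * e k.+1) -> e 0 = limn (discounted_sum gamma g).
Proof.
move=> g0 g1 gC eC ege; apply/le_anti/andP; split.
  by apply: discounted_lower_bound gC eC _ => // k; rewrite -ege.
rewrite -lerN2.
have -> : - limn (discounted_sum gamma g) = limn (discounted_sum gamma (fun k => - g k)).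
  have -> : discounted_sum gamma (fun k => - g k) = - discounted_sum gamma g.
    apply/funext => n; rewrite /discounted_sum [RHS]/GRing.opp /= -sumrN.
    by apply: eq_bigr => k _; rewrite mulrN.
  by rewrite limN //; exact: (cvg_discounted_sum g0 g1 gC).
apply: (@discounted_lower_bound _ _ C _ (fun k => - e k)) => //= k.
- by rewrite normrN.
- by rewrite normrN.
- by rewrite mulrN -opprD -ege.
Qed.

Lemma norm_dist_sum (R : realType) (T : finType) (p : dist R T) (f : T -> R) (C : R) :
  (forall t, `|f t| <= C) -> `|\sum_t p t * f t| <= C.
Proof.
move=> fC; apply: le_trans (ler_norm_sum _ _ _) _.
rewrite -[C]mul1r -(dist_sum1 p) mulr_suml; apply: ler_sum => t _.
by rewrite normrM ger0_norm ?dist_ge0 // ler_wpM2l // dist_ge0.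
Qed.

(** * Uniform bounds on the costs over all beliefs *)

Section bounds.
Context {R : realType} {X U Y : finType}.
Variables (M : pomdp R X U Y) (c : X -> U -> R) (cT : X -> R).
Variables (beta lambda gamma : R).

Lemma terminal_cost_bounded :
  exists C, forall pi, `|terminal_cost cT beta pi| <= C.
Proof.
exists (\sum_x `|cT x| + `|beta| * (#|X|%:R / ln 2)) => pi.
apply: le_trans (ler_normD _ _) _; apply: lerD.
  apply: norm_dist_sum => x; rewrite (bigD1 x) //= lerDl sumr_ge0 //.
by rewrite normrM ler_wpM2l // ger0_norm ?entropy_ge0 ?entropy_le.
Qed.

Lemma stage_cost_bounded :
  exists C, forall pi a, `|stage_cost M c beta lambda pi a| <= C.
Proof.
exists (\sum_x \sum_a `|c x a| + `|beta| * (#|X|%:R * #|X|%:R / ln 2) +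
        `|lambda| * (#|Y|%:R / ln 2)) => pi a.
apply: le_trans (ler_normD _ _) _; apply: lerD.
  apply: le_trans (ler_normD _ _) _; apply: lerD.
    apply: norm_dist_sum => x; rewrite (bigD1 x) //= (bigD1 a) //= -addrA lerDl.
    by rewrite addr_ge0 ?sumr_ge0 // => i _; rewrite sumr_ge0.
  by rewrite normrM ler_wpM2l // ger0_norm ?G2_ge0 ?G2_le.
by rewrite normrM ler_wpM2l // ger0_norm ?entropy_ge0 ?entropy_le.
Qed.

(** These are the weights that summation by parts yields: at stage k, given that the horizon is at
    least k, it ends with probability [1 - gamma] and goes on with probability [gamma]. *)
Lemma belief_costE pi a : belief_cost M c cT beta lambda gamma pi a =
  (1 - gamma) * terminal_cost cT beta pi + gamma * stage_cost M c beta lambda pi a.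
Proof.
rewrite /belief_cost /terminal_cost /stage_cost.
under eq_bigr do rewrite mulrDr mulrCA [_ * (gamma * _)]mulrCA.
rewrite big_split /= -!mulr_sumr; ring.
Qed.

Lemma belief_cost_bounded : 0 <= gamma <= 1 ->
  exists C, forall pi a, `|belief_cost M c cT beta lambda gamma pi a| <= C.
Proof.
case/andP=> g0 g1; have [C1 h1] := terminal_cost_bounded.
have [C2 h2] := stage_cost_bounded.
exists ((1 - gamma) * C1 + gamma * C2) => pi a; rewrite belief_costE.
apply: le_trans (ler_normD _ _) _.
by apply: lerD; rewrite normrM ger0_norm ?subr_ge0 // ler_wpM2l ?subr_ge0.
Qed.

End bounds.

(** * The belief-state decision process *)

Section belief_mdp.
Context {R : realType} {X U Y : finType}.
Variable M : pomdp R X U Y.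
Implicit Types (phi psi : dist R X -> R) (pi : dist R X) (mubar : dist R X -> U).

Definition next_exp phi pi (a : U) : R :=
  \sum_y next_obs M pi a y * phi (bayes M pi a y).

Lemma next_exp_le phi psi pi a : (forall p, phi p <= psi p) ->
  next_exp phi pi a <= next_exp psi pi a.
Proof. by move=> h; apply: ler_sum => y _; rewrite ler_wpM2l ?dist_ge0. Qed.

Lemma next_exp_norm phi pi a C : (forall p, `|phi p| <= C) -> `|next_exp phi pi a| <= C.
Proof. by move=> h; exact: norm_dist_sum. Qed.

(** Transition operator of the belief chain under [mubar]; its n-th iterate gives the expectation of
    [phi] at pi_n from the initial belief. *)
Definition belief_step mubar phi pi : R := next_exp phi pi (mubar pi).

Lemma iter_belief_step_le mubar n phi psi pi : (forall p, phi p <= psi p) ->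
  iter n (belief_step mubar) phi pi <= iter n (belief_step mubar) psi pi.
Proof. by move=> h; elim: n pi => //= n IH pi; apply: next_exp_le. Qed.

Lemma iter_belief_step_norm mubar n phi pi C : (forall p, `|phi p| <= C) ->
  `|iter n (belief_step mubar) phi pi| <= C.
Proof. by move=> h; elim: n pi => //= n IH pi; apply: next_exp_norm. Qed.

Lemma iter_belief_stepD mubar n phi psi r pi :
  iter n (belief_step mubar) (fun p => phi p + r * psi p) pi =
  iter n (belief_step mubar) phi pi + r * iter n (belief_step mubar) psi pi.
Proof.
elim: n pi => //= n IH pi; rewrite /belief_step /next_exp mulr_sumr -big_split /=.
by apply: eq_bigr => y _; rewrite IH; ring.
Qed.

(** * Value iteration and the Bellman equation *)

Section bellman.
Variables (G : dist R X -> U -> R) (C gamma : R) (a0 : U).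
Hypotheses (gamma_gt0 : 0 < gamma) (gamma_lt1 : gamma < 1).
Hypothesis GC : forall pi a, `|G pi a| <= C.

Definition action_value phi pi (a : U) : R := G pi a + gamma * next_exp phi pi a.

Definition greedy phi pi : U := [arg min_(a < a0) action_value phi pi a]%O.

Lemma greedyP phi pi a : action_value phi pi (greedy phi pi) <= action_value phi pi a.
Proof. by rewrite /greedy; case: arg_minP => // i _; apply. Qed.

Definition bellman phi pi : R := action_value phi pi (greedy phi pi).

(* Started above every value, value iteration decreases, so that its pointwise
   limit exists and solves the Bellman equation without any uniformity. *)
Definition value_iteration (n : nat) : dist R X -> R :=
  iter n bellman (fun=> C / (1 - gamma)).

Definition optimal_value pi : R := limn (fun n => value_iteration n pi).

(** The fixed point of d |-> C + gamma d, which therefore bounds all iterates. *)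
Let D := C / (1 - gamma).

Let D_fix : C + gamma * D = D.
Proof. by rewrite /D; field; rewrite subr_eq0 gt_eqF. Qed.

Let C_ge0 : 0 <= C.
Proof.
by have [x _] := dist_inhabited (init M); exact: le_trans (GC (init M) a0).
Qed.

Lemma action_value_le phi psi pi a : (forall p, phi p <= psi p) ->
  action_value phi pi a <= action_value psi pi a.
Proof.
move=> h; rewrite lerD2l; apply: ler_wpM2l (ltW gamma_gt0) _ _ _.
exact: next_exp_le.
Qed.

Lemma bellman_le phi psi pi : (forall p, phi p <= psi p) ->
  bellman phi pi <= bellman psi pi.
Proof. by move=> h; apply: le_trans (greedyP _ _ _) (action_value_le _ _ h). Qed.

Lemma bellman_norm phi pi : (forall p, `|phi p| <= D) -> `|bellman phi pi| <= D.
Proof.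
move=> h; apply: le_trans (ler_normD _ _) _; rewrite -[leRHS]D_fix; apply: lerD => //.
rewrite normrM gtr0_norm //; apply: ler_wpM2l (ltW gamma_gt0) _ _ _.
exact: next_exp_norm.
Qed.

Lemma value_iteration_norm n pi : `|value_iteration n pi| <= D.
Proof.
elim: n pi => [|n IH] pi /=; last exact: bellman_norm.
by rewrite ger0_norm // divr_ge0 // subr_ge0 ltW.
Qed.

(** The iteration starts at [D] and [bellman] preserves the bound [D], so the first step goes down;
    monotonicity of [bellman] propagates this. *)
Lemma value_iteration_decr n pi : value_iteration n.+1 pi <= value_iteration n pi.
Proof.
elim: n pi => [|n IH] pi; last exact: bellman_le.
by apply: le_trans (ler_norm _) _; exact: value_iteration_norm.
Qed.

Let VI_noninc pi : nonincreasing_seq (fun n => value_iteration n pi).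
Proof. by apply/nonincreasing_seqP => n; exact: value_iteration_decr. Qed.

Let cvg_VI pi : cvgn (fun n => value_iteration n pi).
Proof.
apply: nonincreasing_is_cvgn; first exact: VI_noninc.
exists (- D) => _ [n _ <-].
by have := value_iteration_norm n pi; rewrite ler_norml => /andP[].
Qed.

Lemma optimal_value_le n pi : optimal_value pi <= value_iteration n pi.
Proof. exact: (nonincreasing_cvgn_ge (@VI_noninc pi) (@cvg_VI pi)). Qed.

Lemma optimal_value_norm pi : `|optimal_value pi| <= D.
Proof.
rewrite ler_norml; apply/andP; split.
  apply: limr_ge; first exact: cvg_VI.
  by apply: nearW => n; have := value_iteration_norm n pi; rewrite ler_norml => /andP[].
by apply: le_trans (optimal_value_le 0 pi) _; rewrite lexx.
Qed.

(** Observations are finite in number, so pointwise convergence suffices. *)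
Lemma cvg_action_value pi a :
  (fun n => action_value (value_iteration n) pi a) @ \oo -->
  action_value optimal_value pi a.
Proof.
apply: cvgD; first exact: cvg_cst.
apply: cvgMl_tmp; apply: cvg_sumr => y; apply: cvgMl_tmp; exact: cvg_VI.
Qed.

Lemma optimal_value_action_le pi a : optimal_value pi <= action_value optimal_value pi a.
Proof.
apply: (ler_cvg_to (cvg_cst _) (@cvg_action_value pi a)).
apply: nearW => n; apply: le_trans (optimal_value_le n.+1 pi) _; exact: greedyP.
Qed.

(** For the converse inequality, the limit lies below each iterate, so its Bellman image lies below
    the next iterate and hence below the current one. *)
Lemma optimal_value_greedy pi :
  optimal_value pi = action_value optimal_value pi (greedy optimal_value pi).
Proof.
apply/le_anti/andP; split; first exact: optimal_value_action_le.
apply: limr_ge; first exact: cvg_VI.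
apply: nearW => n; apply: le_trans (value_iteration_decr n pi).
by apply: bellman_le => p; exact: optimal_value_le.
Qed.

End bellman.

(** * Discounted value of a stationary belief policy *)

Section policy_value.
Variables (G : dist R X -> U -> R) (C gamma : R).
Hypotheses (gamma_gt0 : 0 < gamma) (gamma_lt1 : gamma < 1).
Hypothesis GC : forall pi a, `|G pi a| <= C.
Variable mubar : dist R X -> U.

Definition policy_cost (k : nat) pi : R :=
  iter k (belief_step mubar) (fun p => G p (mubar p)) pi.

Definition policy_value pi : R :=
  limn (discounted_sum gamma (fun k => policy_cost k pi)).

Lemma policy_cost_norm k pi : `|policy_cost k pi| <= C.
Proof. exact: iter_belief_step_norm. Qed.

(** With e k the expectation of [V] at pi_k, monotonicity of the transition operator carries the
    Bellman inequality to time k, and [discounted_lower_bound] applies. *)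
Lemma policy_value_ge (V : dist R X -> R) (B : R) pi : (forall p, `|V p| <= B) ->
  (forall p a, V p <= action_value G gamma V p a) -> V pi <= policy_value pi.
Proof.
move=> VB VQ.
apply: (@discounted_lower_bound _ _ (Num.max C B) _
  (fun k => iter k (belief_step mubar) V pi)) => // k.
- by rewrite le_max policy_cost_norm.
- by rewrite le_max (@iter_belief_step_norm _ _ _ _ B) ?orbT.
- rewrite /policy_cost iterSr -iter_belief_stepD.
  by apply: iter_belief_step_le => p; exact: VQ.
Qed.

Lemma policy_value_eq (V : dist R X -> R) (B : R) pi : (forall p, `|V p| <= B) ->
  (forall p, V p = action_value G gamma V p (mubar p)) -> V pi = policy_value pi.
Proof.
move=> VB VQ.
apply: (@discounted_recursion _ _ (Num.max C B) _
  (fun k => iter k (belief_step mubar) V pi)) => // k.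
- by rewrite le_max policy_cost_norm.
- by rewrite le_max (@iter_belief_step_norm _ _ _ _ B) ?orbT.
- rewrite /policy_cost iterSr -iter_belief_stepD.
  by congr (iter k _ _ pi); apply/funext => p; exact: VQ.
Qed.

End policy_value.

(** * Expectations under the law of the observations *)

Section obs_law_expectation.
Variables (mubar : dist R X -> U).

(** Induction on n peels off the first observation, which merely restarts the process from the
    updated belief; hence [pi] is general. *)
Lemma sum_cylinders n phi pi :
  \sum_(s : n.-tuple Y)
    (\prod_(k < n) next_obs M (belief_after M mubar pi (take k s))
        (mubar (belief_after M mubar pi (take k s))) (tnth s k)) *
    phi (belief_after M mubar pi s) =
  iter n (belief_step mubar) phi pi.
Proof.
elim: n pi => [|n IH] pi; first by rewrite big_tuple0 big_ord0 mul1r.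
rewrite big_tuple_cons iterS {1}/belief_step /next_exp; apply: eq_bigr => y _.
rewrite -IH mulr_sumr; apply: eq_bigr => s _.
rewrite big_ord_recl tnth0 -mulrA; congr (_ * (_ * _)).
by apply: eq_bigr => k _; rewrite tnthS.
Qed.

Variable pi0 : dist R X.
Let P := obs_law M mubar pi0.

Let measurable_cylinder n (s : n.-tuple Y) :
  measurable (cylinder (M := M) s : set (obs_space M)).
Proof. by apply: sub_sigma_algebra; exists n, s. Qed.

(** Exactly one cylinder of length n contains [w]. Such functions are thus simple, and no
    sigma-algebra on beliefs is called for. *)
Let seq_fun_indic n (f : seq Y -> R) :
  (fun w : obs_space M => f (mkseq w n)) =
  (fun w => \sum_(s : n.-tuple Y) f s * \1_(cylinder (M := M) s) w).
Proof.
apply/funext => w; pose s0 : n.-tuple Y := Tuple (introT eqP (size_mkseq w n)).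
have ts0 (i : 'I_n) : tnth s0 i = w i.
  by rewrite (tnth_nth (w i)) /= nth_mkseq.
rewrite (bigD1 s0) //= indicE mem_set ?mulr1 => [|i]; last by rewrite ts0.
rewrite big1 ?addr0 // => s /negP ss0; rewrite indicE memNset ?mulr0 // => ws.
by apply: ss0; apply/eqP/eq_from_tnth => i; rewrite ts0 ws.
Qed.

Lemma measurable_seq_fun n (f : seq Y -> R) :
  measurable_fun [set: obs_space M] (fun w : obs_space M => f (mkseq w n)).
Proof.
rewrite seq_fun_indic; apply: measurable_sum => s.
by apply: measurable_funM => //; exact: measurable_indic.
Qed.

Lemma integral_belief_process n phi :
  (\int[P]_w (phi (belief_process M mubar pi0 n w))%:E =
   (iter n (belief_step mubar) phi pi0)%:E)%E.
Proof.
rewrite -sum_cylinders -sumEFin.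
under eq_integral do rewrite belief_processE.
have /= E := seq_fun_indic n (fun s => phi (belief_after M mubar pi0 s)).
have Ew w := congr1 (@^~ w) E.
under eq_integral => w _ do rewrite [X in X%:E]Ew -sumEFin.
rewrite integral_sum //; last first.
  move=> s; under eq_fun do rewrite EFinM.
  by apply: integrableZl => //; exact: integrable_indic.
apply: eq_bigr => s _; under eq_integral do rewrite EFinM.
rewrite integralZl //; last exact: integrable_indic.
by rewrite integral_indic // setIT [X in (_ * X)%E]obs_lawP -EFinM mulrC.
Qed.

End obs_law_expectation.

End belief_mdp.

(** * The infinite-horizon value as a limit of expected partial sums *)

Section belief_value.
Context {R : realType} {X U Y : finType}.
Variables (M : pomdp R X U Y) (c : X -> U -> R) (cT : X -> R).
Variables (beta lambda gamma : R).
Hypotheses (gamma_gt0 : 0 < gamma) (gamma_lt1 : gamma < 1).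
Variables (mubar : dist R X -> U) (pi0 : dist R X).

Let P := obs_law M mubar pi0.
Let belief n (w : obs_space M) := belief_process M mubar pi0 n w.

Lemma measurable_belief_process n (phi : dist R X -> R) :
  measurable_fun [set: obs_space M] (fun w => phi (belief n w)).
Proof.
rewrite (_ : (fun w => _) =
    (fun w : obs_space M => phi (belief_after M mubar pi0 (mkseq w n)))).
  exact: (measurable_seq_fun n (fun s => phi (belief_after M mubar pi0 s))).
by apply/funext => w; rewrite /belief belief_processE.
Qed.

Lemma integrable_bounded (f : obs_space M -> R) (C : R) :
  measurable_fun [set: obs_space M] f -> (forall w, `|f w| <= C) ->
  P.-integrable [set: obs_space M] (EFin \o f).
Proof.
move=> mf fC; apply: (@le_integrable _ _ _ _ _ _ _ (EFin \o cst C)) => //.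
- exact/measurable_EFinP.
- by move=> w _; rewrite lee_fin (le_trans (fC w)) // ler_norm.
- exact: finite_measure_integrable_cst.
Qed.

(** Dominated convergence, with the uniform bound [C / (1 - gamma)] on partial sums, moves the limit
    out of the expectation; each partial sum integrates stage by stage. *)
Lemma belief_valueE : belief_value M c cT beta lambda gamma mubar pi0 =
  (policy_value M (belief_cost M c cT beta lambda gamma) gamma mubar pi0)%:E.
Proof.
set G := belief_cost _ _ _ _ _ _.
have [|C GC] := @belief_cost_bounded _ _ _ _ M c cT beta lambda gamma.
  by rewrite !ltW.
pose g p := G p (mubar p).
have gC p : `|g p| <= C by exact: GC.
pose S n (w : obs_space M) := discounted_sum gamma (fun k => g (belief k w)) n.
have mS n : measurable_fun [set: obs_space M] (S n).
  apply: measurable_sum => k; apply: measurable_funM => //.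
  exact: measurable_belief_process.
have cS w : S ^~ w @ \oo --> limn (S ^~ w).
  exact: (cvg_discounted_sum gamma_gt0 gamma_lt1 (fun k => gC _)).
have intS n : (\int[P]_w (S n w)%:E =
    (discounted_sum gamma (fun k => policy_cost M G mubar k pi0) n)%:E)%E.
  rewrite /S /discounted_sum -sumEFin.
  under eq_integral do rewrite -sumEFin.
  have ig k : P.-integrable [set: obs_space M] (fun w => (g (belief k w))%:E).
    by apply: integrable_bounded => //; exact: measurable_belief_process.
  rewrite integral_sum //; last first.
    by move=> k; under eq_fun do rewrite EFinM; exact: integrableZl.
  apply: eq_bigr => k _; under eq_integral do rewrite EFinM.
  by rewrite integralZl // [in LHS]integral_belief_process EFinM.
have lhs : (fun n => \int[P]_w (S n w)%:E)%E @ \oo -->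
    (\int[P]_w (limn (S ^~ w))%:E)%E.
  apply: (@dominated_cvg _ _ _ _ _ measurableT (fun n w => (S n w)%:E)
    (fun w => (limn (S ^~ w))%:E) (cst (C / (1 - gamma))%:E)) => //.
  - by move=> n; exact/measurable_EFinP.
  - by move=> w _; apply: cvg_EFin (cS w); exact: nearW.
  - exact: finite_measure_integrable_cst.
  - by move=> n w _; rewrite lee_fin; exact: discounted_sum_le.
have rhs : (fun n => \int[P]_w (S n w)%:E)%E @ \oo -->
    (policy_value M G gamma mubar pi0)%:E.
  under eq_fun do rewrite intS.
  apply: cvg_EFin; first exact: nearW.
  apply: (cvg_discounted_sum gamma_gt0 gamma_lt1 (C := C)) => k.
  exact: policy_cost_norm.
rewrite /belief_value unlock; exact: (cvg_unique _ lhs rhs).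
Qed.

End belief_value.

(** * The POMDP problem as a discounted problem on information states *)

Section pomdp_value.
Context {R : realType} {X U Y : finType}.
Variables (M : pomdp R X U Y) (c : X -> U -> R) (cT : X -> R).
Variables (beta lambda gamma : R).
Hypotheses (gamma_gt0 : 0 < gamma) (gamma_lt1 : gamma < 1).

Local Notation G := (belief_cost M c cT beta lambda gamma).

Lemma info_exp_norm (mu : policy R U Y) k f C : (forall y u, `|f y u| <= C) ->
  `|info_exp M mu k f| <= C.
Proof.
move=> fC; rewrite ler_norml; apply/andP; split.
  rewrite -[leLHS](info_exp_cst M mu k); apply: info_exp_le => y u.
  by have := fC y u; rewrite ler_norml => /andP[].
rewrite -[leRHS](info_exp_cst M mu k); apply: info_exp_le => y u.
by have := fC y u; rewrite ler_norml => /andP[].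
Qed.

(** The expected cost at the information state (ys, us); the entropy of the
    randomization of U_k is part of H(Y^T, U^{T-1}). *)
Definition info_cost (mu : policy R U Y) (ys : seq Y) (us : seq U) : R :=
  \sum_a mu ys us a * G (filter_belief M ys us) a +
  gamma * lambda * entropy (mu ys us).

Definition pomdp_limit (mu : policy R U Y) : R :=
  limn (discounted_sum gamma (fun k => info_exp M mu k (info_cost mu))).

Lemma info_cost_bounded mu : exists C, forall ys us, `|info_cost mu ys us| <= C.
Proof.
have [|C GC] := @belief_cost_bounded _ _ _ _ M c cT beta lambda gamma.
  by rewrite !ltW.
exists (C + `|gamma * lambda| * (#|U|%:R / ln 2)) => ys us.
apply: le_trans (ler_normD _ _) _; apply: lerD; first exact: norm_dist_sum.
by rewrite normrM ler_wpM2l // ger0_norm ?entropy_ge0 ?entropy_le.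
Qed.

(** The stage decomposition of the cost is averaged over the geometric horizon; summation by parts
    turns it into a discounted sum. *)
Lemma expectation_regularized_cost (mu : policy R U Y)
    (d : measure_display) (Omega : measurableType d) (P : probability Omega R)
    (T : {RV P >-> nat}) :
  (forall t, P (T @^-1` [set t]) = (gamma ^+ t * (1 - gamma))%:E) ->
  'E_P[fun w => regularized_cost M c cT beta lambda mu (T w)]%E =
  (lambda * entropy (obs0_pmf M) + pomdp_limit mu)%:E.
Proof.
move=> Tp; set h := lambda * _.
have [C1 h1] := @terminal_cost_bounded R X cT beta.
have [C2 h2] := stage_cost_bounded M c beta lambda.
pose stage ys us :=
  \sum_a mu ys us a * stage_cost M c beta lambda (filter_belief M ys us) a
  + lambda * entropy (mu ys us).
pose a k := info_exp M mu k (fun ys us => terminal_cost cT beta (filter_belief M ys us)).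
pose s k := info_exp M mu k stage.
pose C := Num.max C1 (C2 + `|lambda| * (#|U|%:R / ln 2)).
have aC k : `|a k| <= C.
  by rewrite le_max; apply/orP; left; apply: info_exp_norm => ys us; exact: h1.
have sC k : `|s k| <= C.
  rewrite le_max; apply/orP; right; apply: info_exp_norm => ys us.
  apply: le_trans (ler_normD _ _) _; apply: lerD; first exact: norm_dist_sum.
  by rewrite normrM ler_wpM2l // ger0_norm ?entropy_ge0 ?entropy_le.
have rE t : regularized_cost M c cT beta lambda mu t = h + a t + \sum_(k < t) s k.
  exact: regularized_cost_sum.
have C0 : 0 <= C by exact: le_trans (aC 0%N).
apply: (expectation_nat Tp (C := (`|h| + C) / (1 - gamma))).
(* The cost at horizon t is at most [(|h| + C) * (t + 1)] in absolute value. *)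
- move=> n; apply: (@le_trans _ _ ((`|h| + C) *
      \sum_(0 <= t < n) gamma ^+ t * (1 - gamma) * t.+1%:R)); last first.
    by rewrite ler_wpM2l ?addr_ge0 // geometric_weights_le.
  rewrite mulr_sumr; apply: ler_sum => t _; rewrite rE mulrCA.
  rewrite ler_wpM2l // ?mulr_ge0 ?exprn_ge0 ?subr_ge0 ?(ltW gamma_gt0) //.
    exact: ltW.
  apply: le_trans (ler_normD _ _) _; apply: (@le_trans _ _ (`|h| + C + C *+ t)).
    apply: lerD; first by apply: le_trans (ler_normD _ _) _; rewrite lerD2l.
    apply: le_trans (ler_norm_sum _ _ _) _.
    apply: (@le_trans _ _ (\sum_(k < t) C)); first exact: ler_sum.
    by rewrite sumr_const card_ord.
  rewrite -natr1 mulrDr mulr1 addrC lerD2r mulrDl -[leLHS]mulr_natr.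
  by rewrite lerDr mulr_ge0.
- have := geometric_stopping_cvg gamma_gt0 gamma_lt1 aC sC rE.
  rewrite /pomdp_limit; congr (_ --> h + limn (discounted_sum gamma _)).
  apply/funext => k; rewrite /a /s -!info_expZ -info_expD.
  apply: eq_info_exp => y u; rewrite /info_cost /stage.
  rewrite [X in _ + X]mulrDr addrA mulrA; congr (_ + _).
  under [RHS]eq_bigr do rewrite belief_costE mulrDr.
  rewrite big_split /= -mulr_suml dist_sum1 mul1r; congr (_ + _).
  by rewrite mulr_sumr; apply: eq_bigr => x _; rewrite mulrCA.
Qed.

(** A function satisfying the Bellman inequality is followed along I_k, for a policy that may depend
    on the whole history. *)
Lemma pomdp_limit_ge (mu : policy R U Y) (V : dist R X -> R) (B : R) : 0 <= lambda ->
  (forall p, `|V p| <= B) -> (forall p a, V p <= action_value M G gamma V p a) ->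
  \sum_y obs0_pmf M y * V (init_belief M y) <= pomdp_limit mu.
Proof.
move=> l0 VB VQ; have [C GC] := info_cost_bounded mu.
rewrite -(info_exp0 M mu (fun ys us => V (filter_belief M ys us))).
apply: (@discounted_lower_bound _ _ (Num.max C B) _
  (fun k => info_exp M mu k (fun ys us => V (filter_belief M ys us)))) => // k.
- by rewrite le_max info_exp_norm.
- by rewrite le_max (@info_exp_norm _ _ _ B) ?orbT.
rewrite info_expS -info_expZ -info_expD; apply: info_exp_le => y u.
(* The randomization entropy is dropped, being nonnegative with weight [gamma * lambda >= 0]. The
   Bellman inequality is then averaged over the control. *)
rewrite /info_cost -addrA addrCA -subr_ge0 -addrA addr_ge0 //.
  by rewrite !mulr_ge0 ?entropy_ge0 // ltW.
rewrite subr_ge0 -[leLHS]mul1r -(dist_sum1 (mu y u)) mulr_suml.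
rewrite /step_exp mulr_sumr -big_split /=; apply: ler_sum => a _.
rewrite mulrCA -mulrDr ler_wpM2l ?dist_ge0 //; apply: le_trans (VQ _ a) _.
rewrite /action_value lerD2l ler_wpM2l ?(ltW gamma_gt0) //.
by apply: ler_sum => b _; rewrite filter_belief_rcons.
Qed.

(** With a Dirac control, one step of the information state acts on functions of the belief as
    [belief_step]; [phi] is general because the induction replaces it by its image. *)
Lemma info_exp_belief_policy mubar k (phi : dist R X -> R) :
  info_exp M (belief_policy M mubar) k (fun ys us => phi (filter_belief M ys us)) =
  \sum_y obs0_pmf M y * iter k (belief_step M mubar) phi (init_belief M y).
Proof.
elim: k phi => [|k IH] phi; first by rewrite info_exp0.
rewrite info_expS; under [RHS]eq_bigr do rewrite iterSr; rewrite -IH.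
apply: eq_info_exp => y u; rewrite /step_exp /belief_policy sum_dirac.
by apply: eq_bigr => b _; rewrite filter_belief_rcons.
Qed.

Lemma pomdp_limit_belief_policy mubar : pomdp_limit (belief_policy M mubar) =
  \sum_y obs0_pmf M y * policy_value M G gamma mubar (init_belief M y).
Proof.
have [|C GC] := @belief_cost_bounded _ _ _ _ M c cT beta lambda gamma.
  by rewrite !ltW.
rewrite /pomdp_limit; apply/cvg_lim => //.
have -> : discounted_sum gamma (fun k => info_exp M (belief_policy M mubar) k
     (info_cost (belief_policy M mubar))) =
   (fun n => \sum_y obs0_pmf M y * discounted_sum gamma
      (fun k => policy_cost M G mubar k (init_belief M y)) n).
  apply/funext => n; rewrite /discounted_sum.
  under [RHS]eq_bigr do rewrite mulr_sumr.
  rewrite [RHS]exchange_big; apply: eq_bigr => k _ /=.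
  under [RHS]eq_bigr do rewrite mulrCA.
  rewrite -mulr_sumr -(info_exp_belief_policy mubar k (fun p => G p (mubar p))).
  congr (_ * _); apply: eq_info_exp => y u.
  by rewrite /info_cost /belief_policy sum_dirac entropy_dirac mulr0 addr0.
apply: cvg_sumr => y; apply: cvgMl_tmp.
by apply: (cvg_discounted_sum gamma_gt0 gamma_lt1 (C := C)) => k; exact: policy_cost_norm.
Qed.

End pomdp_value.

(** * Equality of the optimal values *)

Lemma ereal_inf_attained (R : realType) (S : set (\bar R)) (x : \bar R) :
  S x -> (forall y, S y -> (x <= y)%E) -> ereal_inf S = x.
Proof.
move=> Sx xS; apply/le_anti; rewrite ereal_inf_lbound //=.
exact: le_ereal_inf_tmp.
Qed.

Local Open Scope ereal_scope.

Theorem mainTheorem1 (R : realType) (X U Y : finType) (M : pomdp R X U Y)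
    (c : X -> U -> R) (cT : X -> R) (beta lambda gamma : R)
    (d : measure_display) (Omega : measurableType d) (P : probability Omega R)
    (T : {RV P >-> nat})
    (U_nonempty : (0 < #|U|)%N)
    (beta_ge0 : (0 <= beta)%R) (lambda_ge0 : (0 <= lambda)%R)
    (gamma_gt0 : (0 < gamma)%R) (gamma_lt1 : (gamma < 1)%R)
    (T_geometric : forall t : nat,
      P (T @^-1` [set t]) = (gamma ^+ t * (1 - gamma))%:E) :
  (* E_T[J_mu^T + beta H_mu(X^T | Y^T, U^{T-1}) + lambda H_mu(Y^T, U^{T-1})] *)
  let pomdp_value (mu : policy R U Y) :=
    'E_P[fun w => regularized_cost M c cT beta lambda mu (T w)] in
  (* E_mubar[sum_k gamma^k G(pi_k, U_k) | pi_0], for a given pi_0 *)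
  let mdp_value (mubar : dist R X -> U) (pi0 : dist R X) :=
    belief_value M c cT beta lambda gamma mubar pi0 in
  let H0 := (lambda * entropy (obs0_pmf M))%:E in
  [/\ (* the optimal values agree when pi_0 is averaged over Y_0, whether mubar
         is optimized before or after observing Y_0 *)
      ereal_inf [set pomdp_value mu | mu in [set: policy R U Y]] =
        H0 + ereal_inf
          [set \sum_(y0 : Y) (obs0_pmf M y0)%:E * mdp_value mubar (init_belief M y0)
             | mubar in [set: dist R X -> U]],
      ereal_inf [set pomdp_value mu | mu in [set: policy R U Y]] =
        H0 + \sum_(y0 : Y) (obs0_pmf M y0)%:E *
          ereal_inf [set mdp_value mubar (init_belief M y0)
             | mubar in [set: dist R X -> U]]
    & (* and playing U_k = mubar(pi_k) in the POMDP has the cost of mubar *)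
      forall mubar : dist R X -> U,
        pomdp_value (belief_policy M mubar) =
        H0 + \sum_(y0 : Y) (obs0_pmf M y0)%:E * mdp_value mubar (init_belief M y0)].
Proof.
(* The arg min in [greedy] needs a starting control. *)
have [a0 _] := card_gt0P U_nonempty.
move=> pomdp_value mdp_value H0.
pose G := belief_cost M c cT beta lambda gamma.
have [|C GC] := belief_cost_bounded M c cT beta lambda (gamma := gamma).
  by rewrite !ltW.
pose V := optimal_value M G C gamma a0.
have V_norm : forall pi, (`|V pi| <= C / (1 - gamma))%R.
  exact: optimal_value_norm.
have V_le : forall pi a, (V pi <= action_value M G gamma V pi a)%R.
  exact: optimal_value_action_le.
pose star : dist R X -> U := greedy M G gamma a0 V.
have V_star pi : V pi = policy_value M G gamma star pi.
  apply: (policy_value_eq gamma_gt0 gamma_lt1 GC pi V_norm) => p.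
  exact: optimal_value_greedy.
pose W := (\sum_y obs0_pmf M y * V (init_belief M y))%R.
have mdpE mubar pi : mdp_value mubar pi = (policy_value M G gamma mubar pi)%:E.
  exact: belief_valueE.
have mdp_ge mubar pi : (V pi)%:E <= mdp_value mubar pi.
  rewrite mdpE lee_fin.
  exact: (policy_value_ge gamma_gt0 gamma_lt1 GC mubar pi V_norm V_le).
have mdp_star pi : mdp_value star pi = (V pi)%:E by rewrite mdpE -V_star.
have pomdpE mu : pomdp_value mu = H0 + (pomdp_limit M c cT beta lambda gamma mu)%:E.
  exact: expectation_regularized_cost.
have belief_policyE mubar : pomdp_value (belief_policy M mubar) =
    H0 + \sum_(y0 : Y) (obs0_pmf M y0)%:E * mdp_value mubar (init_belief M y0).
  rewrite pomdpE pomdp_limit_belief_policy // -sumEFin.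
  by congr (_ + _); apply: eq_bigr => y _; rewrite mdpE EFinM.
have sumV (f : dist R X -> \bar R) : (forall pi, f pi = (V pi)%:E) ->
    \sum_(y0 : Y) (obs0_pmf M y0)%:E * f (init_belief M y0) = W%:E.
  by move=> fV; rewrite -sumEFin; apply: eq_bigr => y _; rewrite fV EFinM.
(* The infimum is attained by playing [star] on the filtered belief; [pomdp_limit_ge] covers all
   other policies. *)
have inf_pomdp : ereal_inf [set pomdp_value mu | mu in [set: policy R U Y]] = H0 + W%:E.
  apply: ereal_inf_attained => [|_ [mu _ <-]].
    by exists (belief_policy M star) => //; rewrite belief_policyE (sumV (mdp_value star)).
  rewrite pomdpE leeD2l // lee_fin.
  exact: (pomdp_limit_ge gamma_gt0 gamma_lt1 mu lambda_ge0 V_norm V_le).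
split=> //.
- rewrite inf_pomdp; congr (_ + _); apply/esym/ereal_inf_attained => [|_ [mubar _ <-]].
    by exists star => //; exact: sumV.
  rewrite -(sumV (EFin \o V)) //; apply: lee_sum => y _.
  by apply: lee_wpmul2l; [rewrite lee_fin obs0_pmf_ge0 | exact: mdp_ge].
- rewrite inf_pomdp; congr (_ + _).
  (* The single policy [star] is optimal from every initial belief, so choosing [mubar] after seeing
     Y_0 brings no gain. *)
  rewrite (sumV (fun pi =>
    ereal_inf [set mdp_value mubar pi | mubar in [set: dist R X -> U]])) //.
  move=> pi; apply: ereal_inf_attained => [|_ [mubar _ <-]]; last exact: mdp_ge.
  by exists star.
Qed.
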